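(* Let $f\in\mathcal{F}(\alpha,\lambda,n)$. Then, for $|z|=r<1$, $$r\left[|\lambda|\left(\frac{r}{n+2}-\frac{1}{n+1}\right)r^n-\frac r2+1\right]\le|f(z)|\le r\left[|\lambda|\left(\frac{r}{n+2}+\frac{1}{n+1}\right)r^n+\frac r2+1\right].$$ The inequalities are sharp.
   Context: $\mathbb{D}=\{z\in\mathbb{C}:|z|<1\}$ is the open unit disk and $\mathbb{N}=\{1,2,3,\ldots\}$. $\mathcal{H}$ is the class of harmonic functions $f=h+\overline{g}$ in $\mathbb{D}$, with $h,g$ analytic in $\mathbb{D}$, normalized by $f(0)=f_z(0)-1=0$, which have the form $f(z)=z+\sum_{k=2}^{\infty}a_kz^k+\overline{\sum_{k=1}^{\infty}b_kz^k}$ for $z\in\mathbb{D}$. For $1<\alpha\le 3/2$, $n\in\mathbb{N}$ and $\lambda\in\mathbb{C}$ with $|\lambda|\le\frac1{n+1}$, $\mathcal{F}(\alpha,\lambda,n)$ is the class of harmonic mappings $f=h+\overline{g}\in\mathcal{H}$ such that $\mathrm{Re}\left(1+\frac{zh''(z)}{h'(z)}\right)<\alpha$ and $g'(z)=\lambda z^nh'(z)$ for $z\in\mathbb{D}$.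
   Formalization: Sharpness is stated for α = 3/2 only (for every admissible n and λ, each bound is attained for all r in [0,1)); for α < 3/2 the bounds, which do not depend on α, are strict for r > 0, e.g. α = 5/4, λ = 0, so sharpness fails there. *)

(* Defs.v *)
From Stdlib Require Import Reals.
From Coquelicot Require Import Coquelicot.
Open Scope R_scope.

Definition in_disk (z : C) : Prop := Cmod z < 1.

(* [ex_derive] on functions [C -> C] is complex differentiability. *)
Definition analytic_in_disk (h : C -> C) : Prop :=
  forall z : C, in_disk z -> ex_derive h z.

(* [f] is in the class H, with canonical decomposition f = h + conj g.
   Functions are total on [C], but only their values on the disk matter.
   Since the conjugate of g is antianalytic, f_z = h', so the normalization
   f_z(0) = 1 reads h'(0) = 1.  The two series are
   h(z) = z + sum_(k >= 2) a_k z^k and g(z) = sum_(k >= 1) b_k z^k. *)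
Definition class_H (f h g : C -> C) : Prop :=
  analytic_in_disk h /\ analytic_in_disk g /\
  (forall z : C, in_disk z -> f z = (h z + Cconj (g z))%C) /\
  f (RtoC 0) = RtoC 0 /\ C_derive h (RtoC 0) = RtoC 1 /\
  exists a b : nat -> C, forall z : C, in_disk z ->
    is_series (fun k : nat => (a (k + 2)%nat * z ^ (k + 2))%C) (h z - z)%C /\
    is_series (fun k : nat => (b (k + 1)%nat * z ^ (k + 1))%C) (g z).

(* The clause h'(z) <> 0 makes explicit that the quotient is defined:
   division by 0 is total in Coquelicot. *)
Definition class_F (alpha : R) (lambda : C) (n : nat) (f : C -> C) : Prop :=
  exists h g : C -> C, class_H f h g /\
    forall z : C, in_disk z ->
      C_derive h z <> RtoC 0 /\
      Re (1 + z * C_derive (C_derive h) z / C_derive h z)%C < alpha /\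
      C_derive g z = (lambda * z ^ n * C_derive h z)%C.

Definition growth_lower (lambda : C) (n : nat) (r : R) : R :=
  r * (Cmod lambda * (r / (INR n + 2) - 1 / (INR n + 1)) * r ^ n - r / 2 + 1).

Definition growth_upper (lambda : C) (n : nat) (r : R) : R :=
  r * (Cmod lambda * (r / (INR n + 2) + 1 / (INR n + 1)) * r ^ n + r / 2 + 1).

(* Main.v *)
Require Import Defs.
From Stdlib Require Import Reals Lra Lia.
From Coquelicot Require Import Coquelicot.
Open Scope R_scope.

(** Let f = h + conj(g) belong to the class, let z = r zeta with |zeta| = 1, and
    put m = |lambda|.

    The analytic part.  The condition Re (1 + z h'' / h') < 3 / 2 with h'(0) = 1
    implies |h'(z) - 1| <= |z|.  Write h' = 1 - z phi, and let z0 be a point of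
    the circle |z| = r where |phi| is maximal; by the maximum principle it is
    maximal over the whole closed disk.  The derivatives of |phi| at z0 then show
    that z0 phi'(z0) / phi(z0) is real and nonnegative, which contradicts the
    condition unless r |phi(z0)| < 1.  Let r tend to 1
    ([log_derivative_Schwarz_bound]).  The maximum principle itself is proved
    for power series, by comparing the value at a point with the sum over the
    vertices of a small square around it.

    The growth bounds.  Along the ray,
      d/dt (conj(zeta) f(t zeta)) = p + conj(lambda zeta^(n+2)) t^n conj(p),
    where p = h'(t zeta).  Its modulus is at most (1 + m t^n) (1 + t), whose
    integral from 0 to r is the upper bound ([class_F_upper]).

    The lower bound is the integral of (1 - m t^n) (1 - t), which is a lower
    bound for the same modulus.  But the direction of the derivative varies
    with t, so that the moduli cannot simply be integrated.  The classical
    remedy is to integrate along the preimage of a segment, which requires f to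
    be univalent.  Instead, one real functional w -> Re (e w), with |e| = 1 fixed
    along the ray, is used: using only |1 - p| <= t, the derivative of
    Re (e conj(zeta) f(t zeta)) is bounded below by an explicit polynomial in t,
    and a suitable e makes its integral at least the lower bound
    ([direction_for_lower_bound], [class_F_lower]).  The polynomial need not be
    bounded below pointwise by (1 - m t^n) (1 - t): only the integrals compare.

    Sharpness.  The maps with h' = 1 - eps z, |eps| = 1, attain the bounds on the
    diameter through conj(eps), for a rotation eps chosen so that the two parts
    of f are aligned there ([extremal_rotation], [extremal_value]). *)

(** * Complex derivatives *)

(** Series and derivatives produce equalities typed in the abelian group or
    module structure of C, which [ring] does not see as equalities in C. *)
Ltac ring_in_C := match goal with |- ?x = ?y => change (@eq C x y) end; ring.

(** Complex differentiability in the Landau form f w = f z + l (w - z) + o(w - z),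
    which is handier than quotients for estimates on series. *)
Definition has_Cderiv (f : C -> C) (z l : C) : Prop :=
  forall eps : R, 0 < eps -> exists delta : R, 0 < delta /\
    forall w : C, Cmod (w - z) < delta ->
      Cmod (f w - f z - l * (w - z)) <= eps * Cmod (w - z).

Lemma is_derive_has_Cderiv (f : C -> C) (z l : C) :
  is_derive f z l <-> has_Cderiv f z l.
Proof.
split.
- intros [_ H] eps He.
  destruct (H z (fun P HP => HP) (mkposreal eps He)) as [d Hd].
  exists d; split; [apply cond_pos|]; intros w Hw.
  generalize (Hd w Hw); simpl.
  unfold minus, scal, plus, opp, norm; simpl.
  intro H'. replace (f w - f z - l * (w - z))%C with (f w + - f z + - ((w + - z) * l))%C by ring.
  exact H'.
- intro H; split; [apply is_linear_scal_l|].
  intros y Hy.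
  assert (Hyz : y = z).
  { symmetry; apply is_filter_lim_locally_unique; exact Hy. }
  subst y. intros [eps He].
  destruct (H eps He) as [d [Hd Hf]].
  exists (mkposreal d Hd); intros w Hw.
  generalize (Hf w Hw); simpl.
  unfold minus, scal, plus, opp, norm; simpl.
  intro H'. replace (f w - f z - l * (w - z))%C with (f w + - f z + - ((w + - z) * l))%C in H' by ring.
  exact H'.
Qed.

(** C as a module over itself and C as a normed space carry different uniform
    structures in the type of [is_derive]; both give the same derivative. *)
Lemma is_derive_regular_module (f : C -> C) (z l : C) :
  is_derive (K := C_AbsRing) (V := AbsRing_NormedModule C_AbsRing) f z l <-> has_Cderiv f z l.
Proof.
rewrite <- is_derive_has_Cderiv; split; intros [_ H]; (split; [apply is_linear_scal_l|exact H]).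
Qed.

Lemma has_Cderiv_const (c z : C) : has_Cderiv (fun _ => c) z 0.
Proof. apply is_derive_has_Cderiv. exact (is_derive_const (V := C_NormedModule) c z). Qed.

Lemma has_Cderiv_id (z : C) : has_Cderiv (fun w => w) z 1.
Proof. apply is_derive_regular_module. exact (is_derive_id (K := C_AbsRing) z). Qed.

Lemma has_Cderiv_plus (f g : C -> C) (z l m : C) :
  has_Cderiv f z l -> has_Cderiv g z m -> has_Cderiv (fun w => f w + g w)%C z (l + m)%C.
Proof.
rewrite <- !is_derive_has_Cderiv. exact (is_derive_plus (V := C_NormedModule) f g z l m).
Qed.

Lemma has_Cderiv_mult (f g : C -> C) (z l m : C) :
  has_Cderiv f z l -> has_Cderiv g z m ->
  has_Cderiv (fun w => f w * g w)%C z (l * g z + f z * m)%C.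
Proof.
rewrite <- !is_derive_regular_module. intros Hf Hg.
exact (is_derive_mult (K := C_AbsRing) f g z l m Hf Hg Cmult_comm).
Qed.

Lemma has_Cderiv_pow (z : C) (n : nat) :
  has_Cderiv (fun w => w ^ S n)%C z (INR (S n) * z ^ n)%C.
Proof.
induction n as [|n IH].
- replace (INR 1 * z ^ 0)%C with (1 * 1 + z * 0)%C by (simpl; ring).
  apply (has_Cderiv_mult (fun w => w) (fun _ => 1%C)); [apply has_Cderiv_id|apply has_Cderiv_const].
- replace (INR (S (S n)) * z ^ S n)%C with (1 * z ^ S n + z * (INR (S n) * z ^ n))%C
    by (rewrite (S_INR (S n)), RtoC_plus, Cpow_S; ring).
  apply (has_Cderiv_mult (fun w => w) (fun w => w ^ S n)%C); [apply has_Cderiv_id|exact IH].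
Qed.

Lemma has_Cderiv_monomial (c z : C) (n : nat) :
  has_Cderiv (fun w => c * w ^ S n)%C z (c * INR (S n) * z ^ n)%C.
Proof.
replace (c * INR (S n) * z ^ n)%C with (0 * z ^ S n + c * (INR (S n) * z ^ n))%C by ring.
apply (has_Cderiv_mult (fun _ => c) (fun w => w ^ S n)%C); [apply has_Cderiv_const|apply has_Cderiv_pow].
Qed.

Lemma has_Cderiv_unique (f : C -> C) (z l : C) : has_Cderiv f z l -> C_derive f z = l.
Proof. rewrite <- is_derive_has_Cderiv; apply is_C_derive_unique. Qed.

Lemma has_Cderiv_ext_disk (f g : C -> C) (z l : C) :
  Cmod z < 1 -> (forall w, Cmod w < 1 -> f w = g w) -> has_Cderiv f z l -> has_Cderiv g z l.
Proof.
intros Hz Hfg Hf eps He. destruct (Hf eps He) as [d [Hd H]].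
exists (Rmin d (1 - Cmod z)); split; [apply Rmin_pos; lra|].
intros w Hw.
rewrite <- !Hfg; [apply H, Rlt_le_trans with (1 := Hw), Rmin_l| exact Hz |].
replace w with (z + (w - z))%C by ring.
apply Rle_lt_trans with (1 := Cmod_triangle _ _).
generalize (Rlt_le_trans _ _ _ Hw (Rmin_r _ _)); lra.
Qed.

Lemma has_Cderiv_ext (f g : C -> C) (z l : C) :
  (forall w, f w = g w) -> has_Cderiv f z l -> has_Cderiv g z l.
Proof.
intros Hfg Hf eps He. destruct (Hf eps He) as [d [Hd H]]. exists d; split; [exact Hd|].
intros w Hw. rewrite <- !Hfg. apply H, Hw.
Qed.

(** * Series of complex numbers *)

Lemma is_series_Cmod (a : nat -> C) (l : C) :
  is_series a l <->
  (forall eps : R, 0 < eps -> exists N : nat, forall n : nat, (N <= n)%nat ->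
     Cmod (sum_n a n - l) < eps).
Proof.
split; intro H.
- intros eps He.
  exact (proj1 (@filterlim_locally_ball_norm C_AbsRing nat C_NormedModule
           eventually _ _ l) H (mkposreal eps He)).
- apply (proj2 (@filterlim_locally_ball_norm C_AbsRing nat C_NormedModule
           eventually _ _ l)).
  intros [eps He]; exact (H eps He).
Qed.

Lemma is_series_real (a : nat -> R) (l : R) :
  is_series a l <->
  (forall eps : R, 0 < eps -> exists N : nat, forall n : nat, (N <= n)%nat ->
     Rabs (sum_n a n - l) < eps).
Proof.
split; intro H.
- intros eps He.
  exact (proj1 (@filterlim_locally nat R_UniformSpace
           eventually _ _ l) H (mkposreal eps He)).
- apply (proj2 (@filterlim_locally nat R_UniformSpace eventually _ _ l)).
  intros [eps He]; exact (H eps He).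
Qed.

Lemma Cmod_series_le (a : nat -> C) (b : nat -> R) (l : C) (B : R) :
  (forall k, Cmod (a k) <= b k) -> is_series a l -> is_series b B -> Cmod l <= B.
Proof.
intros Hab Ha Hb.
apply Rnot_lt_le; intro Hlt.
destruct (proj1 (is_series_Cmod _ _) Ha ((Cmod l - B) / 2)) as [N1 H1]; [lra|].
destruct (proj1 (is_series_real _ _) Hb ((Cmod l - B) / 2)) as [N2 H2]; [lra|].
set (n := max N1 N2).
specialize (H1 n (Nat.le_max_l _ _)). specialize (H2 n (Nat.le_max_r _ _)).
assert (Hs : Cmod (sum_n a n) <= sum_n b n).
{ clear -Hab. induction n as [|n IH].
  - rewrite !sum_O; apply Hab.
  - rewrite !sum_Sn. apply Rle_trans with (1 := Cmod_triangle _ _).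
    apply Rplus_le_compat; auto. }
assert (Ht : Cmod l <= Cmod (sum_n a n) + Cmod (sum_n a n - l)).
{ rewrite <- (Cmod_opp (sum_n a n - l)).
  replace l with (sum_n a n + - (sum_n a n - l))%C at 1 by ring.
  apply Cmod_triangle. }
apply Rabs_def2 in H2. lra.
Qed.

Lemma is_series_C_term_bounded (a : nat -> C) (l : C) :
  is_series a l -> exists B : R, forall k, Cmod (a k) <= B.
Proof.
intros Ha.
destruct (proj1 (is_series_Cmod _ _) Ha 1 Rlt_0_1) as [N HN].
assert (Hfin : forall n, exists B, 0 <= B /\ forall k, (k <= n)%nat -> Cmod (a k) <= B).
{ intro n; induction n as [|n [B [HB0 HB]]].
  - exists (Cmod (a O)); split; [apply Cmod_ge_0|].
    intros k Hk; replace k with O by lia; lra.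
  - exists (Rmax B (Cmod (a (S n)))); split.
    + apply Rle_trans with (1 := HB0), Rmax_l.
    + intros k Hk. destruct (proj1 (Nat.lt_eq_cases _ _) Hk) as [Hl|He].
      * apply Rle_trans with B; [apply HB; lia|apply Rmax_l].
      * subst k; apply Rmax_r. }
destruct (Hfin N) as [B [HB0 HB]].
exists (B + 2); intro k.
destruct (Nat.le_gt_cases k N) as [Hk|Hk].
- specialize (HB k Hk); lra.
- destruct k as [|k]; [lia|].
  assert (H1 := HN k ltac:(lia)). assert (H2 := HN (S k) ltac:(lia)).
  rewrite sum_Sn in H2. 
  change (plus (sum_n a k) (a (S k))) with (Cplus (sum_n a k) (a (S k))) in H2.
  replace (a (S k)) with ((sum_n a k + a (S k) - l) + - (sum_n a k - l))%C by ring.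
  eapply Rle_trans; [apply Cmod_triangle|]. rewrite Cmod_opp; lra.
Qed.

Lemma is_series_single (a : nat -> C) (j : nat) :
  (forall k, k <> j -> a k = 0%C) -> is_series a (a j).
Proof.
intro Ha. apply is_series_Cmod. intros eps He. exists j. intros n Hn.
replace (sum_n a n) with (a j).
- replace (a j - a j)%C with (0 : C) by ring. rewrite Cmod_0; exact He.
- assert (Hlt : forall m, (m < j)%nat -> sum_n a m = RtoC 0).
  { intros m Hm; induction m as [|m IH].
    - rewrite sum_O. apply Ha; lia.
    - rewrite sum_Sn, IH, Ha by lia. unfold plus; simpl. ring_in_C. }
  induction n as [|n IH].
  + rewrite sum_O. f_equal; lia.
  + rewrite sum_Sn. destruct (Nat.eq_dec j (S n)) as [E|E].
    * rewrite Hlt, E by lia. unfold plus; simpl. ring_in_C.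
    * rewrite <- IH, (Ha (S n)) by lia. unfold plus; simpl. ring_in_C.
Qed.

(** * Power series on the unit disk *)

(** Coefficients of w and w ^ 2 in (z + w) ^ k, by recursion on k so that the
    estimate below can follow the same recursion. *)
Fixpoint pow_coef1 (z : C) (k : nat) : C :=
  match k with
  | O => 0%C
  | S k => (z * pow_coef1 z k + z ^ k)%C
  end.

Fixpoint pow_coef2 (z : C) (k : nat) : C :=
  match k with
  | O => 0%C
  | S k => (z * pow_coef2 z k + pow_coef1 z k)%C
  end.

Lemma pow_coef1_S (z : C) (k : nat) :
  pow_coef1 z (S k) = (INR (S k) * z ^ k)%C.
Proof.
induction k as [|k IH].
- simpl; ring.
- change (pow_coef1 z (S (S k))) with (z * pow_coef1 z (S k) + z ^ S k)%C.
  rewrite IH, (S_INR (S k)), RtoC_plus, Cpow_S; ring.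
Qed.

(** The four terms are dominated by the binomial expansion of (rho + eta) ^ k,
    so that each coefficient is bounded by (rho + eta) ^ k over a power of eta.
    Derivatives and mean values of power series both come from this single
    majorant, which is summable against the coefficients when rho + eta < 1. *)
Lemma Cpow_expansion (z w : C) (rho eta : R) (k : nat) :
  Cmod z <= rho -> Cmod w <= eta ->
  exists E : C,
    ((z + w) ^ k = z ^ k + pow_coef1 z k * w + pow_coef2 z k * w ^ 2 + E * w ^ 3)%C /\
    Cmod (z ^ k) + Cmod (pow_coef1 z k) * eta + Cmod (pow_coef2 z k) * eta ^ 2
      + Cmod E * eta ^ 3 <= (rho + eta) ^ k.
Proof.
intros Hz Hw.
assert (H0z := Cmod_ge_0 z). assert (H0w := Cmod_ge_0 w).
induction k as [|k [E [HE HB]]].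
- exists 0%C; split; [simpl; ring|].
  simpl; rewrite Cmod_0, Cmod_1; lra.
- exists ((z + w) * E + pow_coef2 z k)%C; split.
  + rewrite Cpow_S, HE; simpl; ring.
  + simpl pow_coef1; simpl pow_coef2; rewrite Cpow_S.
    assert (Hzw : Cmod (z + w) <= rho + eta).
    { apply Rle_trans with (1 := Cmod_triangle _ _); lra. }
    set (p0 := Cmod (z ^ k)) in *. set (p1 := Cmod (pow_coef1 z k)) in *.
    set (p2 := Cmod (pow_coef2 z k)) in *. set (p3 := Cmod E) in *.
    assert (H0 : 0 <= p0) by apply Cmod_ge_0.
    assert (H1 : 0 <= p1) by apply Cmod_ge_0.
    assert (H2 : 0 <= p2) by apply Cmod_ge_0.
    assert (H3 : 0 <= p3) by apply Cmod_ge_0.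
    assert (B0 : Cmod (z * z ^ k) <= rho * p0).
    { rewrite Cmod_mult; apply Rmult_le_compat_r; auto. }
    assert (B1 : Cmod (z * pow_coef1 z k + z ^ k) <= rho * p1 + p0).
    { apply Rle_trans with (1 := Cmod_triangle _ _); rewrite Cmod_mult.
      apply Rplus_le_compat_r, Rmult_le_compat_r; auto. }
    assert (B2 : Cmod (z * pow_coef2 z k + pow_coef1 z k) <= rho * p2 + p1).
    { apply Rle_trans with (1 := Cmod_triangle _ _); rewrite Cmod_mult.
      apply Rplus_le_compat_r, Rmult_le_compat_r; auto. }
    assert (B3 : Cmod ((z + w) * E + pow_coef2 z k) <= (rho + eta) * p3 + p2).
    { apply Rle_trans with (1 := Cmod_triangle _ _); rewrite Cmod_mult.
      apply Rplus_le_compat_r, Rmult_le_compat_r; auto. }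
    assert (He : 0 <= eta) by lra.
    apply Rle_trans with ((rho + eta) * (p0 + p1 * eta + p2 * eta ^ 2 + p3 * eta ^ 3)).
    * apply (Rmult_le_compat_r eta) in B1; [|lra].
      apply (Rmult_le_compat_r (eta ^ 2)) in B2; [|apply pow_le; lra].
      apply (Rmult_le_compat_r (eta ^ 3)) in B3; [|apply pow_le; lra].
      lra.
    * simpl pow; apply Rmult_le_compat_l; [lra|exact HB].
Qed.

Definition power_series_on_disk (a : nat -> C) (f : C -> C) : Prop :=
  forall z : C, Cmod z < 1 -> is_series (fun k => (a k * z ^ k)%C) (f z).

(** The terms are bounded at a radius between rho and 1: compare with a
    geometric series. *)
Lemma power_series_abs (a : nat -> C) (f : C -> C) (rho : R) :
  power_series_on_disk a f -> 0 <= rho < 1 ->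
  ex_series (fun k => Cmod (a k) * rho ^ k).
Proof.
intros Ha Hrho.
set (R1 := (1 + rho) / 2).
assert (HR : rho < R1 < 1) by (unfold R1; lra).
assert (HR1 : Cmod R1 < 1) by (rewrite Cmod_R, Rabs_pos_eq; lra).
destruct (is_series_C_term_bounded _ _ (Ha _ HR1)) as [B HB].
apply (ex_series_le (K := R_AbsRing) (V := R_CompleteNormedModule)) with (fun k => B * (rho / R1) ^ k).
- intro k. change (norm (Cmod (a k) * rho ^ k)) with (Rabs (Cmod (a k) * rho ^ k)).
  assert (H0 := Cmod_ge_0 (a k)).
  rewrite Rabs_pos_eq; [|apply Rmult_le_pos; [auto|apply pow_le; lra]].
  specialize (HB k); rewrite Cmod_mult, Cmod_pow, Cmod_R, Rabs_pos_eq in HB by lra.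
  replace rho with (R1 * (rho / R1)) at 1 by (field; lra).
  rewrite Rpow_mult_distr, <- Rmult_assoc.
  apply Rmult_le_compat_r; [|exact HB].
  apply pow_le; apply Rdiv_le_0_compat; lra.
- apply (ex_series_scal (K := R_AbsRing) (V := R_NormedModule)).
  apply ex_series_geom.
  rewrite Rabs_pos_eq; [|apply Rdiv_le_0_compat; lra].
  apply Rlt_div_l; lra.
Qed.

(** Differentiation term by term: the remainder of order k is at most
    |w - z|^2 |a k| (|z| + eta)^k / eta^2. *)
Lemma power_series_derive_aux (a : nat -> C) (f : C -> C) (z : C) :
  power_series_on_disk a f -> Cmod z < 1 ->
  exists l, is_series (fun k => (INR (S k) * a (S k) * z ^ k)%C) l /\ has_Cderiv f z l.
Proof.
intros Ha Hz. assert (H0z := Cmod_ge_0 z).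
set (eta := (1 - Cmod z) / 2).
assert (Heta : 0 < eta) by (unfold eta; lra).
assert (Hsum : 0 <= Cmod z + eta < 1) by (unfold eta; lra).
destruct (power_series_abs a f _ Ha Hsum) as [B HB].
assert (Hex : ex_series (fun k => (a k * pow_coef1 z k)%C : C_NormedModule)).
{ apply (ex_series_le (K := C_AbsRing) (V := C_CompleteNormedModule))
    with (fun k => / eta * (Cmod (a k) * (Cmod z + eta) ^ k)).
  - intro k. change (norm (a k * pow_coef1 z k)%C) with (Cmod (a k * pow_coef1 z k)).
    destruct (Cpow_expansion z 0 (Cmod z) eta k) as [E [_ HE]]; [lra|rewrite Cmod_0; lra|].
    rewrite Cmod_mult.
    apply Rmult_le_reg_l with eta; [lra|].
    rewrite <- (Rmult_assoc eta (/ eta)), Rinv_r, Rmult_1_l by lra.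
    assert (H0 := Cmod_ge_0 (z ^ k)). assert (H1 := Cmod_ge_0 (pow_coef2 z k)).
    assert (H2 := Cmod_ge_0 E). assert (H3 := Cmod_ge_0 (a k)).
    assert (0 <= Cmod (pow_coef2 z k) * eta ^ 2) by (apply Rmult_le_pos; [auto|apply pow_le; lra]).
    assert (0 <= Cmod E * eta ^ 3) by (apply Rmult_le_pos; [auto|apply pow_le; lra]).
    replace (eta * (Cmod (a k) * Cmod (pow_coef1 z k)))
      with (Cmod (a k) * (Cmod (pow_coef1 z k) * eta)) by ring.
    apply Rmult_le_compat_l; lra.
  - apply (ex_series_scal (K := R_AbsRing) (V := R_NormedModule)). exists B; exact HB. }
destruct Hex as [l Hl].
exists l; split.
- assert (H := is_series_incr_n (fun k => (a k * pow_coef1 z k)%C : C_NormedModule) 1 l Nat.lt_0_1).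
  apply (is_series_ext (fun k => (a (1 + k)%nat * pow_coef1 z (1 + k))%C)).
  + intro k; simpl (1 + k)%nat; rewrite pow_coef1_S; ring_in_C.
  + apply H. simpl. rewrite sum_O. 
    replace (plus l _) with l; [exact Hl|].
    simpl; rewrite Cmult_0_r; symmetry; exact (Cplus_0_r l).
- intros eps Heps.
  set (K := B / eta ^ 2).
  exists (Rmin eta (eps / (Rabs K + 1))); split.
  { apply Rmin_pos; [lra|]. apply Rdiv_lt_0_compat; [lra|]. assert (H := Rabs_pos K); lra. }
  intros w Hw.
  set (d := (w - z)%C) in *.
  assert (Hd : Cmod d <= eta).
  { apply Rlt_le, Rlt_le_trans with (1 := Hw), Rmin_l. }
  assert (Hwd : w = (z + d)%C) by (unfold d; ring).
  assert (Hw1 : Cmod w < 1).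
  { rewrite Hwd; apply Rle_lt_trans with (1 := Cmod_triangle _ _); lra. }
  assert (Hd0 := Cmod_ge_0 d).
  apply Rle_trans with (Cmod d ^ 2 * K).
  + apply (Cmod_series_le (fun k => (a k * w ^ k + - (a k * z ^ k) + - (d * (a k * pow_coef1 z k)))%C)
             (fun k => (Cmod d ^ 2 / eta ^ 2) * (Cmod (a k) * (Cmod z + eta) ^ k))).
    * intro k.
      destruct (Cpow_expansion z d (Cmod z) eta k) as [E [HE HEB]]; [lra|exact Hd|].
      rewrite Hwd, HE.
      replace (a k * (z ^ k + pow_coef1 z k * d + pow_coef2 z k * d ^ 2 + E * d ^ 3)
         + - (a k * z ^ k) + - (d * (a k * pow_coef1 z k)))%C
        with (a k * (d ^ 2 * (pow_coef2 z k + E * d)))%C by ring.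
      rewrite !Cmod_mult, Cmod_pow.
      assert (H1 := Cmod_ge_0 (a k)).
      replace (Cmod d ^ 2 / eta ^ 2 * (Cmod (a k) * (Cmod z + eta) ^ k))
        with (Cmod (a k) * (Cmod d ^ 2 * ((Cmod z + eta) ^ k / eta ^ 2))) by (field; lra).
      apply Rmult_le_compat_l; [exact H1|].
      apply Rmult_le_compat_l; [apply pow_le; lra|].
      apply Rle_div_r; [apply pow_lt; lra|].
      apply Rle_trans with (2 := HEB).
      apply Rle_trans with ((Cmod (pow_coef2 z k) + Cmod E * eta) * eta ^ 2).
      -- apply Rmult_le_compat_r; [apply pow_le; lra|].
         apply Rle_trans with (1 := Cmod_triangle _ _); rewrite Cmod_mult.
         apply Rplus_le_compat_l, Rmult_le_compat_l; [apply Cmod_ge_0|exact Hd].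
      -- assert (H2 := Cmod_ge_0 (z ^ k)).
         assert (0 <= Cmod (pow_coef1 z k) * eta) by (apply Rmult_le_pos; [apply Cmod_ge_0|lra]).
         lra.
    * replace (f w - f z - l * d)%C with (f w + - f z + - (d * l))%C by ring.
      apply (is_series_plus (V := C_NormedModule)).
      -- apply (is_series_plus (V := C_NormedModule)); [apply Ha, Hw1|].
         apply (is_series_opp (V := C_NormedModule)), Ha, Hz.
      -- apply (is_series_opp (V := C_NormedModule)).
         apply (is_series_scal (V := C_NormedModule) d _ l Hl).
    * replace (Cmod d ^ 2 * K) with (Cmod d ^ 2 / eta ^ 2 * B) by (unfold K; field; lra).
      apply (is_series_scal (V := R_NormedModule) (Cmod d ^ 2 / eta ^ 2) _ B HB).
  + assert (Hd2 : Cmod d <= eps / (Rabs K + 1)).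
    { apply Rlt_le, Rlt_le_trans with (1 := Hw), Rmin_r. }
    assert (HK := Rle_abs K). assert (HK0 := Rabs_pos K).
    apply Rle_div_r in Hd2; [|lra].
    simpl. rewrite Rmult_1_r.
    apply Rle_trans with (Cmod d * (Cmod d * (Rabs K + 1))).
    * rewrite Rmult_assoc. apply Rmult_le_compat_l; [lra|]. apply Rmult_le_compat_l; lra.
    * rewrite Rmult_comm. apply Rmult_le_compat_r; lra.
Qed.

Lemma power_series_derive (a : nat -> C) (f : C -> C) :
  power_series_on_disk a f ->
  power_series_on_disk (fun k => INR (S k) * a (S k))%C (C_derive f) /\
  forall z, Cmod z < 1 -> has_Cderiv f z (C_derive f z).
Proof.
intro Ha; split; intros z Hz;
  destruct (power_series_derive_aux a f z Ha Hz) as [l [Hl Hd]];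
  rewrite (is_C_derive_unique f z l) by (apply is_derive_has_Cderiv, Hd); auto.
Qed.

Lemma Cpow_Lipschitz (z w : C) (r eta : R) (k : nat) :
  Cmod z <= r -> Cmod w <= r -> 0 < eta ->
  Cmod (z ^ k - w ^ k) <= Cmod (z - w) * ((r + eta) ^ k / eta).
Proof.
intros Hz Hw Heta.
assert (H0z := Cmod_ge_0 z). assert (H0 := Cmod_ge_0 (z - w)).
induction k as [|k IH].
- simpl. replace (1 - 1)%C with (0 : C) by ring. rewrite Cmod_0.
  apply Rmult_le_pos; [auto|]. apply Rdiv_le_0_compat; lra.
- rewrite !Cpow_S.
  replace (z * z ^ k - w * w ^ k)%C with (z * (z ^ k - w ^ k) + (z - w) * w ^ k)%C by ring.
  apply Rle_trans with (1 := Cmod_triangle _ _); rewrite !Cmod_mult, Cmod_pow.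
  assert (Hwk : Cmod w ^ k <= (r + eta) ^ k).
  { apply pow_incr; split; [apply Cmod_ge_0|lra]. }
  replace (Cmod (z - w) * ((r + eta) ^ S k / eta))
    with (r * (Cmod (z - w) * ((r + eta) ^ k / eta)) + Cmod (z - w) * (r + eta) ^ k)
    by (simpl; field; lra).
  apply Rplus_le_compat.
  + apply Rmult_le_compat; auto using Cmod_ge_0.
  + apply Rmult_le_compat_l; auto.
Qed.

Lemma power_series_Lipschitz (a : nat -> C) (f : C -> C) (r : R) :
  power_series_on_disk a f -> 0 <= r < 1 ->
  exists K, 0 <= K /\ forall z w, Cmod z <= r -> Cmod w <= r ->
    Cmod (f z - f w) <= K * Cmod (z - w).
Proof.
intros Ha Hr.
set (eta := (1 - r) / 2).
assert (Heta : 0 < eta) by (unfold eta; lra).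
assert (Hsum : 0 <= r + eta < 1) by (unfold eta; lra).
destruct (power_series_abs a f _ Ha Hsum) as [B HB].
assert (Hbound : forall z w, Cmod z <= r -> Cmod w <= r ->
    Cmod (f z - f w) <= B / eta * Cmod (z - w)).
{ intros z w Hz Hw.
  apply (Cmod_series_le (fun k => (a k * z ^ k + - (a k * w ^ k))%C)
           (fun k => Cmod (z - w) / eta * (Cmod (a k) * (r + eta) ^ k))).
  - intro k.
    replace (a k * z ^ k + - (a k * w ^ k))%C with (a k * (z ^ k - w ^ k))%C by ring.
    rewrite Cmod_mult.
    replace (Cmod (z - w) / eta * (Cmod (a k) * (r + eta) ^ k))
      with (Cmod (a k) * (Cmod (z - w) * ((r + eta) ^ k / eta))) by (field; lra).
    apply Rmult_le_compat_l; [apply Cmod_ge_0|].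
    apply Cpow_Lipschitz; auto.
  - apply (is_series_plus (V := C_NormedModule)); [apply Ha; lra|].
    apply (is_series_opp (V := C_NormedModule)), Ha; lra.
  - replace (B / eta * Cmod (z - w)) with (Cmod (z - w) / eta * B) by (field; lra).
    apply (is_series_scal (V := R_NormedModule) (Cmod (z - w) / eta) _ B HB). }
exists (Rabs (B / eta)); split; [apply Rabs_pos|].
intros z w Hz Hw. apply Rle_trans with (1 := Hbound z w Hz Hw).
apply Rmult_le_compat_r; [apply Cmod_ge_0|apply Rle_abs].
Qed.

(** The four points z + i^j d are the vertices of a square centred at z: the
    terms of first and second order in d cancel in the sum.  This replaces the
    mean value property over circles. *)
Lemma power_series_four_points (a : nat -> C) (f : C -> C) (z : C) :
  power_series_on_disk a f -> Cmod z < 1 ->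
  exists eta K, 0 < eta /\ 0 <= K /\ forall d, 0 <= d <= eta ->
    Cmod (f (z + d) + f (z - d) + f (z + Ci * d) + f (z - Ci * d) - 4 * f z)%C <= K * d ^ 3.
Proof.
intros Ha Hz. assert (H0z := Cmod_ge_0 z).
set (eta := (1 - Cmod z) / 2).
assert (Heta : 0 < eta) by (unfold eta; lra).
assert (Hsum : 0 <= Cmod z + eta < 1) by (unfold eta; lra).
destruct (power_series_abs a f _ Ha Hsum) as [B HB].
assert (He3 : 0 < eta ^ 3) by (apply pow_lt; lra).
exists eta, (Rabs (4 * B / eta ^ 3)).
split; [exact Heta|split; [apply Rabs_pos|]].
intros d Hd.
assert (Hd3 : 0 <= d ^ 3) by (apply pow_le; lra).
apply Rle_trans with (4 * B / eta ^ 3 * d ^ 3);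
  [|apply Rmult_le_compat_r; [exact Hd3|apply Rle_abs]].
assert (Hdm : Cmod d = d) by (rewrite Cmod_R; apply Rabs_pos_eq; lra).
assert (Hdi : Cmod (Ci * d) = d) by (rewrite Cmod_mult, Cmod_Ci; lra).
assert (Hser : forall w, Cmod w = d -> is_series (fun k => (a k * (z + w) ^ k)%C) (f (z + w)%C)).
{ intros w Hw; apply Ha. apply Rle_lt_trans with (1 := Cmod_triangle _ _); lra. }
apply (Cmod_series_le
  (fun k => a k * (z + d) ^ k + a k * (z + - d) ^ k + a k * (z + Ci * d) ^ k
            + a k * (z + - (Ci * d)) ^ k + - (4 * (a k * z ^ k)))%C
  (fun k => 4 * d ^ 3 / eta ^ 3 * (Cmod (a k) * (Cmod z + eta) ^ k))).
- intro k.
  destruct (Cpow_expansion z d (Cmod z) eta k) as [E1 [H1 B1]]; [lra|lra|].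
  destruct (Cpow_expansion z (- d) (Cmod z) eta k) as [E2 [H2 B2]]; [lra|rewrite Cmod_opp; lra|].
  destruct (Cpow_expansion z (Ci * d) (Cmod z) eta k) as [E3 [H3 B3]]; [lra|lra|].
  destruct (Cpow_expansion z (- (Ci * d)) (Cmod z) eta k) as [E4 [H4 B4]]; [lra|rewrite Cmod_opp; lra|].
  rewrite H1, H2, H3, H4.
  assert (Hi : (Ci ^ 2)%C = (- (1))%C).
  { simpl; unfold Ci, Cmult, Copp, RtoC; simpl; f_equal; ring. }
  match goal with |- Cmod ?X <= _ => 
    replace X with (a k * ((d : C) ^ 3 * (E1 - E2 + Ci ^ 3 * (E3 - E4))
       + 2 * (d : C) ^ 2 * pow_coef2 z k * (1 + Ci ^ 2)))%C by ring end.
  rewrite Hi. replace (1 + - (1))%C with (0:C) by ring. rewrite Cmult_0_r, Cplus_0_r.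
  rewrite !Cmod_mult, Cmod_pow, Hdm.
  replace (4 * d ^ 3 / eta ^ 3 * (Cmod (a k) * (Cmod z + eta) ^ k))
    with (Cmod (a k) * (d ^ 3 * (4 * (Cmod z + eta) ^ k / eta ^ 3))) by (field; lra).
  apply Rmult_le_compat_l; [apply Cmod_ge_0|].
  apply Rmult_le_compat_l; [exact Hd3|].
  apply Rle_div_r; [exact He3|].
  assert (HE : Cmod (E1 - E2 + Ci ^ 3 * (E3 - E4)) <= Cmod E1 + Cmod E2 + (Cmod E3 + Cmod E4)).
  { apply Rle_trans with (1 := Cmod_triangle _ _). apply Rplus_le_compat.
    - apply Rle_trans with (1 := Cmod_triangle _ _); rewrite Cmod_opp; lra.
    - rewrite Cmod_mult, Cmod_pow, Cmod_Ci, pow1, Rmult_1_l.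
      apply Rle_trans with (1 := Cmod_triangle _ _); rewrite Cmod_opp; lra. }
  apply (Rmult_le_compat_r (eta ^ 3)) in HE; [|lra].
  assert (0 <= Cmod (z ^ k)) by apply Cmod_ge_0.
  assert (0 <= Cmod (pow_coef1 z k) * eta) by (apply Rmult_le_pos; [apply Cmod_ge_0|lra]).
  assert (0 <= Cmod (pow_coef2 z k) * eta ^ 2)
    by (apply Rmult_le_pos; [apply Cmod_ge_0|apply pow_le; lra]).
  lra.
- unfold Cminus.
  repeat apply (is_series_plus (V := C_NormedModule)).
  + apply Hser; auto.
  + apply Hser; rewrite Cmod_opp; auto.
  + apply Hser; auto.
  + apply Hser; rewrite Cmod_opp; auto.
  + apply (is_series_opp (V := C_NormedModule)).
    apply (is_series_scal (V := C_NormedModule) (4 : C)), Ha, Hz.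
- replace (4 * B / eta ^ 3 * d ^ 3) with (4 * d ^ 3 / eta ^ 3 * B) by (field; lra).
  apply (is_series_scal (V := R_NormedModule) (4 * d ^ 3 / eta ^ 3) _ B HB).
Qed.

(** * Polar coordinates and compactness *)

(** If the supremum M were not attained, the gap M - G would be positive
    everywhere, hence bounded away from 0 by compactness. *)
Lemma Lipschitz_max_rectangle (G : R -> R -> R) (a b a' b' K : R) :
  a <= b -> a' <= b' ->
  (forall x y u v, a <= x <= b -> a' <= y <= b' -> a <= u <= b -> a' <= v <= b' ->
     G x y - G u v <= K * (Rabs (x - u) + Rabs (y - v))) ->
  exists u v, a <= u <= b /\ a' <= v <= b' /\
    forall x y, a <= x <= b -> a' <= y <= b' -> G x y <= G u v.
Proof.
intros Hab Hab' HG.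
set (E := fun g => exists x y, a <= x <= b /\ a' <= y <= b' /\ g = G x y).
assert (HE : bound E).
{ exists (G a a' + Rabs K * ((b - a) + (b' - a'))). intros g (x & y & Hx & Hy & ->).
  assert (H := HG x y a a' Hx Hy ltac:(lra) ltac:(lra)).
  assert (H2 : Rabs (x - a) + Rabs (y - a') <= (b - a) + (b' - a')).
  { rewrite !Rabs_pos_eq by lra; lra. }
  assert (H0 : 0 <= Rabs (x - a) + Rabs (y - a')).
  { generalize (Rabs_pos (x - a)) (Rabs_pos (y - a')); lra. }
  assert (K * (Rabs (x - a) + Rabs (y - a')) <= Rabs K * (Rabs (x - a) + Rabs (y - a'))).
  { apply Rmult_le_compat_r; [exact H0|apply Rle_abs]. }
  assert (Rabs K * (Rabs (x - a) + Rabs (y - a')) <= Rabs K * (b - a + (b' - a'))).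
  { apply Rmult_le_compat_l; [apply Rabs_pos|exact H2]. }
  lra. }
destruct (completeness E HE) as [M [HM1 HM2]].
{ exists (G a a'), a, a'; repeat split; lra. }
destruct (Classical_Prop.classic (exists u v, a <= u <= b /\ a' <= v <= b' /\ G u v = M))
  as [(u & v & Hu & Hv & Huv)|Hno].
{ exists u, v; split; [exact Hu|split; [exact Hv|]].
  intros x y Hx Hy; rewrite Huv; apply HM1; exists x, y; auto. }
exfalso.
set (L := 4 * Rabs K + 2).
assert (HK := Rabs_pos K).
assert (HL : 0 < L) by (unfold L; lra).
assert (Hlt : forall u v, a <= u <= b -> a' <= v <= b' -> 0 < M - G u v).
{ intros u v Hu Hv.
  assert (G u v <= M) by (apply HM1; exists u, v; auto).
  assert (G u v <> M) by (intro; apply Hno; exists u, v; auto). lra. }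
(* The radius at a point is proportional to the gap M - G there, so that a
   uniform lower bound on the radii is a uniform lower bound on the gap. *)
set (delta := fun u v => match Rlt_dec 0 (Rabs (M - G u v) / L) with
   | left H => mkposreal _ H | right _ => mkposreal 1 Rlt_0_1 end).
assert (Hdelta : forall u v, a <= u <= b -> a' <= v <= b' -> M - G u v = L * delta u v).
{ intros u v Hu Hv. specialize (Hlt u v Hu Hv). unfold delta.
  destruct (Rlt_dec 0 (Rabs (M - G u v) / L)) as [H|H]; simpl.
  - rewrite Rabs_pos_eq by lra. field; lra.
  - exfalso; apply H. apply Rdiv_lt_0_compat; [apply Rabs_pos_lt; lra|exact HL]. }
destruct (compactness_value_2d a b a' b' delta) as [d Hd].
assert (Hd0 := cond_pos d).
assert (Hub : is_upper_bound E (M - d)).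
{ intros g (x & y & Hx & Hy & ->).
  apply Rnot_lt_le; intro Hc.
  apply (Hd x y Hx Hy); intros (u & v & Hu & Hv & Hxu & Hyv & Hdd).
  specialize (HG x y u v Hx Hy Hu Hv).
  specialize (Hdelta u v Hu Hv). set (e := pos (delta u v)) in *.
  assert (H0 : 0 <= Rabs (x - u) + Rabs (y - v)).
  { generalize (Rabs_pos (x - u)) (Rabs_pos (y - v)); lra. }
  assert (K * (Rabs (x - u) + Rabs (y - v)) <= Rabs K * (Rabs (x - u) + Rabs (y - v))).
  { apply Rmult_le_compat_r; [exact H0|apply Rle_abs]. }
  assert (Rabs K * (Rabs (x - u) + Rabs (y - v)) <= Rabs K * (2 * e)).
  { apply Rmult_le_compat_l; lra. }
  unfold L in Hdelta.
  assert (0 <= Rabs K * e) by (apply Rmult_le_pos; lra).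
  lra. }
specialize (HM2 _ Hub). lra.
Qed.

Definition cis (t : R) : C := (cos t, sin t).

Lemma Cmod_cis (t : R) : Cmod (cis t) = 1.
Proof.
unfold Cmod, cis; simpl.
replace (_ + _) with 1; [apply sqrt_1|].
generalize (sin2_cos2 t); unfold Rsqr; lra.
Qed.

Lemma unit_is_cis (z : C) : Cmod z = 1 -> exists t, - PI <= t <= PI /\ z = cis t.
Proof.
destruct z as [x y]; intro H.
assert (H2 : x * x + y * y = 1).
{ generalize (Cmod2_alt (x, y)); rewrite H; simpl; lra. }
assert (Hx : -1 <= x <= 1) by nra.
assert (Hb := acos_bound x).
assert (Hs : sin (acos x) = Rabs y).
{ rewrite sin_acos by exact Hx. rewrite <- sqrt_Rsqr_abs; f_equal; unfold Rsqr; lra. }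
destruct (Rle_lt_dec 0 y) as [Hy|Hy].
- exists (acos x); split; [lra|]. unfold cis; rewrite cos_acos, Hs, Rabs_pos_eq; auto.
- exists (- acos x); split; [lra|]. unfold cis.
  rewrite cos_neg, sin_neg, cos_acos, Hs, Rabs_left by auto. f_equal; ring.
Qed.

Lemma polar (z : C) : exists t, - PI <= t <= PI /\ z = (Cmod z * cis t)%C.
Proof.
destruct (Ceq_dec z 0) as [->|Hz].
- exists 0; split; [generalize PI_RGT_0; lra|rewrite Cmod_0; ring].
- assert (H0 : 0 < Cmod z) by (apply Cmod_gt_0, Hz).
  assert (Hc : RtoC (Cmod z) <> 0%C) by (intro H; apply RtoC_inj in H; lra).
  destruct (unit_is_cis (z / Cmod z)) as [t [Ht E]].
  { rewrite Cmod_div, Cmod_R, Rabs_pos_eq by (auto; lra). field; lra. }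
  exists t; split; [exact Ht|]. rewrite <- E; field; exact Hc.
Qed.

Lemma unit_polar (z : C) : exists u : C, Cmod u = 1 /\ z = (Cmod z * u)%C.
Proof. destruct (polar z) as [t [_ E]]. exists (cis t); split; [apply Cmod_cis|exact E]. Qed.

Lemma cis_Lipschitz (s t : R) : Cmod (cis s - cis t) <= 2 * Rabs (s - t).
Proof.
assert (Hc : Rabs (cos s - cos t) <= Rabs (s - t)).
{ destruct (MVT_abs cos (fun x => - sin x) t s) as [c [Hc _]].
  { intros; apply derivable_pt_lim_cos. }
  rewrite Hc, Rabs_Ropp. assert (H := SIN_bound c).
  assert (H' : Rabs (sin c) <= 1) by (apply Rabs_le; lra).
  generalize (Rabs_pos (s - t)); nra. }
assert (Hs : Rabs (sin s - sin t) <= Rabs (s - t)).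
{ destruct (MVT_abs sin cos t s) as [c [Hs _]].
  { intros; apply derivable_pt_lim_sin. }
  rewrite Hs. assert (H := COS_bound c).
  assert (H' : Rabs (cos c) <= 1) by (apply Rabs_le; lra).
  generalize (Rabs_pos (s - t)); nra. }
replace (cis s - cis t)%C with (RtoC (cos s - cos t) + Ci * RtoC (sin s - sin t))%C
  by (unfold cis, Ci, RtoC, Cminus, Cplus, Cmult, Copp; simpl; f_equal; ring).
apply Rle_trans with (1 := Cmod_triangle _ _).
rewrite Cmod_mult, Cmod_Ci, !Cmod_R. lra.
Qed.

Lemma cis_pow (t : R) (n : nat) : (cis t ^ n)%C = cis (INR n * t).
Proof.
induction n as [|n IH].
- simpl. unfold cis. rewrite Rmult_0_l, cos_0, sin_0. reflexivity.
- rewrite Cpow_S, IH, S_INR, Rmult_plus_distr_r, Rmult_1_l, Rplus_comm.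
  unfold cis, Cmult; simpl. rewrite cos_plus, sin_plus. f_equal; ring.
Qed.

Lemma unit_root_exists (w : C) (n : nat) :
  Cmod w = 1 -> exists eps : C, Cmod eps = 1 /\ (eps ^ S n)%C = w.
Proof.
intro Hw. destruct (unit_is_cis w Hw) as [t [_ ->]].
exists (cis (t / INR (S n))); split; [apply Cmod_cis|].
rewrite cis_pow; f_equal. field. apply not_0_INR; lia.
Qed.

Lemma Cmult_conj_unit (u : C) : Cmod u = 1 -> (u * Cconj u)%C = 1%C.
Proof. intro H. rewrite <- Cmod2_conj, H. f_equal; ring. Qed.

(** The closed disk is the case r1 = 0, the circle the case r1 = r. *)
Lemma Lipschitz_max_annulus (F : C -> R) (r1 r K : R) :
  0 <= r1 <= r -> 0 <= K ->
  (forall z w, Cmod z <= r -> Cmod w <= r -> F z - F w <= K * Cmod (z - w)) ->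
  exists z0, r1 <= Cmod z0 <= r /\ forall z, r1 <= Cmod z <= r -> F z <= F z0.
Proof.
intros Hr HK HF.
destruct (Lipschitz_max_rectangle (fun t x => F (t * cis x)%C) r1 r (- PI) PI (K * (1 + 2 * r)))
  as (t & x & Ht & Hx & Hmax).
- lra.
- generalize PI_RGT_0; lra.
- intros t x t' x' Ht Hx Ht' Hx'.
  assert (Hm : forall s y, r1 <= s <= r -> Cmod (s * cis y) <= r).
  { intros s y Hs; rewrite Cmod_mult, Cmod_cis, Cmod_R, Rabs_pos_eq; lra. }
  apply Rle_trans with (1 := HF _ _ (Hm t x Ht) (Hm t' x' Ht')).
  rewrite Rmult_assoc. apply Rmult_le_compat_l; [exact HK|].
  replace (t * cis x - t' * cis x')%C
    with (RtoC (t - t') * cis x + t' * (cis x - cis x'))%C by (rewrite RtoC_minus; ring).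
  apply Rle_trans with (1 := Cmod_triangle _ _).
  rewrite !Cmod_mult, Cmod_cis, !Cmod_R, (Rabs_pos_eq t') by lra.
  assert (H := cis_Lipschitz x x').
  assert (H1 := Rabs_pos (t - t')). assert (H2 := Rabs_pos (x - x')).
  assert (H3 := Cmod_ge_0 (cis x - cis x')).
  assert (t' * Cmod (cis x - cis x') <= r * (2 * Rabs (x - x'))) by (apply Rmult_le_compat; lra).
  assert (0 <= r * Rabs (t - t')) by (apply Rmult_le_pos; lra).
  lra.
- exists (t * cis x)%C.
  rewrite Cmod_mult, Cmod_cis, Cmod_R, Rabs_pos_eq, Rmult_1_r by lra.
  split; [exact Ht|]. intros z Hz.
  destruct (polar z) as [y [Hy E]]. rewrite E. apply Hmax; auto.
Qed.

(** * The maximum principle *)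

Lemma Cmod2_Re_Im (z : C) : Cmod z ^ 2 = Re z * Re z + Im z * Im z.
Proof. rewrite Cmod2_alt; ring. Qed.

(** The term eps |z|^2 makes the function strictly subharmonic, as the maximum
    principle requires; with eps = 0 this also covers |f|^2 itself. *)
Lemma perturbed_modulus_Lipschitz (a : nat -> C) (f : C -> C) (r eps : R) :
  power_series_on_disk a f -> 0 <= r < 1 -> 0 <= eps ->
  exists K, 0 <= K /\ forall z w, Cmod z <= r -> Cmod w <= r ->
    (Cmod (f z) ^ 2 + eps * Cmod z ^ 2) - (Cmod (f w) ^ 2 + eps * Cmod w ^ 2)
      <= K * Cmod (z - w).
Proof.
intros Ha Hr Heps.
destruct (power_series_Lipschitz a f r Ha Hr) as [K [HK HL]].
set (B := Cmod (f 0) + K).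
assert (HB : forall z, Cmod z <= r -> Cmod (f z) <= B).
{ intros z Hz.
  replace (f z) with (f 0 + (f z - f 0))%C by ring.
  apply Rle_trans with (1 := Cmod_triangle _ _). unfold B. apply Rplus_le_compat_l.
  apply Rle_trans with (1 := HL z 0%C Hz ltac:(rewrite Cmod_0; lra)).
  replace (z - 0)%C with z by ring.
  rewrite <- (Rmult_1_r K) at 2. apply Rmult_le_compat_l; lra. }
assert (Hsq : forall u v : C, Rabs (Cmod u - Cmod v) <= Cmod (u - v)).
{ intros u v. apply Rabs_le; split.
  - assert (H := Cmod_triangle u (v - u)). replace (u + (v - u))%C with v in H by ring.
    replace (Cmod (v - u)) with (Cmod (u - v)) in H
      by (rewrite <- Cmod_opp; f_equal; ring). lra.
  - assert (H := Cmod_triangle v (u - v)). replace (v + (u - v))%C with u in H by ring. lra. }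
assert (HB0 : 0 <= B).
{ apply Rle_trans with (2 := HB 0%C ltac:(rewrite Cmod_0; lra)); apply Cmod_ge_0. }
exists (2 * B * K + 2 * eps); split.
{ assert (0 <= B * K) by (apply Rmult_le_pos; lra). lra. }
intros z w Hz Hw.
assert (H1 := HL z w Hz Hw).
assert (H2 := Rle_trans _ _ _ (Rle_abs _) (Hsq (f z) (f w))).
assert (H3 := Rle_trans _ _ _ (Rle_abs _) (Hsq z w)).
assert (H4 := HB z Hz). assert (H5 := HB w Hw).
assert (P1 := Cmod_ge_0 (f z)). assert (P2 := Cmod_ge_0 (f w)).
assert (P3 := Cmod_ge_0 z). assert (P4 := Cmod_ge_0 w).
assert (P5 := Cmod_ge_0 (z - w)).
set (d := Cmod (z - w)) in *.
assert (Q1 : (Cmod (f z) - Cmod (f w)) * (Cmod (f z) + Cmod (f w)) <= (K * d) * (2 * B)).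
{ apply Rle_trans with ((K * d) * (Cmod (f z) + Cmod (f w))).
  - apply Rmult_le_compat_r; lra.
  - apply Rmult_le_compat_l; [apply Rmult_le_pos; lra|lra]. }
assert (Q2 : (Cmod z - Cmod w) * (Cmod z + Cmod w) <= d * 2).
{ apply Rle_trans with (d * (Cmod z + Cmod w)).
  - apply Rmult_le_compat_r; lra.
  - apply Rmult_le_compat_l; lra. }
apply (Rmult_le_compat_l eps) in Q2; [|exact Heps].
lra.
Qed.

(** Over the four points z0 + i^j d the sum of |f|^2 is at least
    4 |f z0|^2 - O(d^3), while the sum of eps |z|^2 exceeds 4 eps |z0|^2 by
    4 eps d^2: for small d the sum exceeds four times the value at z0. *)
Lemma perturbed_modulus_no_interior_max (a : nat -> C) (f : C -> C) (z0 : C) (r eps : R) :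
  power_series_on_disk a f -> Cmod z0 < r -> r <= 1 -> 0 < eps ->
  (forall z, Cmod z <= r ->
     Cmod (f z) ^ 2 + eps * Cmod z ^ 2 <= Cmod (f z0) ^ 2 + eps * Cmod z0 ^ 2) ->
  False.
Proof.
intros Ha Hz0 Hr Heps Hmax.
destruct (power_series_four_points a f z0 Ha ltac:(lra)) as (eta & K & Heta & HK & H4).
set (T := 2 * Cmod (f z0) * K + 1).
assert (Hf0 := Cmod_ge_0 (f z0)).
assert (HT : 0 < T).
{ assert (0 <= Cmod (f z0) * K) by (apply Rmult_le_pos; lra). unfold T; lra. }
set (d := Rmin eta (Rmin (r - Cmod z0) (2 * eps / T))).
assert (Hd : 0 < d).
{ unfold d; repeat apply Rmin_pos; try lra. apply Rdiv_lt_0_compat; lra. }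
assert (Hd1 : d <= eta) by apply Rmin_l.
assert (Hd2 : d <= r - Cmod z0) by (unfold d; eapply Rle_trans; [apply Rmin_r|apply Rmin_l]).
assert (Hd3 : d <= 2 * eps / T) by (unfold d; eapply Rle_trans; [apply Rmin_r|apply Rmin_r]).
specialize (H4 d ltac:(lra)).
assert (Hdm : Cmod d = d) by (rewrite Cmod_R; apply Rabs_pos_eq; lra).
assert (Hdi : Cmod (Ci * d) = d) by (rewrite Cmod_mult, Cmod_Ci; lra).
assert (M : forall w, Cmod w = d -> Cmod (z0 + w) <= r).
{ intros w Hw. apply Rle_trans with (1 := Cmod_triangle _ _); lra. }
assert (M1 := Hmax _ (M d Hdm)).
assert (M2 := Hmax _ (M (- d)%C ltac:(rewrite Cmod_opp; exact Hdm))).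
assert (M3 := Hmax _ (M (Ci * d)%C Hdi)).
assert (M4 := Hmax _ (M (- (Ci * d))%C ltac:(rewrite Cmod_opp; exact Hdi))).
fold (Cminus z0 d) in M2. fold (Cminus z0 (Ci * d)) in M4.
set (f1 := f (z0 + d)%C) in *. set (f2 := f (z0 - d)%C) in *.
set (f3 := f (z0 + Ci * d)%C) in *. set (f4 := f (z0 - Ci * d)%C) in *.
set (f0 := f z0) in *.
set (S := (f1 + f2 + f3 + f4 - 4 * f0)%C) in *.
assert (HS : - (Cmod f0 * (K * d ^ 3)) <= Re (Cconj f0 * S)).
{ assert (H := re_le_Cmod (Cconj f0 * S)). rewrite Cmod_mult, Cmod_conj in H.
  assert (Cmod f0 * Cmod S <= Cmod f0 * (K * d ^ 3)) by (apply Rmult_le_compat_l; auto).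
  generalize (Rabs_maj2 (Re (Cconj f0 * S))); lra. }
(* |f_j|^2 >= 2 Re (conj f0 f_j) - |f0|^2 at each of the four points. *)
assert (HP : 2 * Re (Cconj f0 * S) + 4 * Cmod f0 ^ 2
   <= Cmod f1 ^ 2 + Cmod f2 ^ 2 + Cmod f3 ^ 2 + Cmod f4 ^ 2).
{ rewrite !Cmod2_Re_Im. unfold S. clearbody f0 f1 f2 f3 f4.
  clear. destruct f0 as [x0 y0], f1 as [x1 y1], f2 as [x2 y2], f3 as [x3 y3], f4 as [x4 y4].
  simpl.
  generalize (Rle_0_sqr (x1 - x0)) (Rle_0_sqr (x2 - x0)) (Rle_0_sqr (x3 - x0)) (Rle_0_sqr (x4 - x0))
   (Rle_0_sqr (y1 - y0)) (Rle_0_sqr (y2 - y0)) (Rle_0_sqr (y3 - y0)) (Rle_0_sqr (y4 - y0)).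
  unfold Rsqr; lra. }
assert (HZ : Cmod (z0 + d) ^ 2 + Cmod (z0 - d) ^ 2 + Cmod (z0 + Ci * d) ^ 2 + Cmod (z0 - Ci * d) ^ 2
   = 4 * Cmod z0 ^ 2 + 4 * d ^ 2).
{ rewrite !Cmod2_Re_Im. destruct z0 as [x0 y0]; simpl. ring. }
assert (HF : 4 * eps * d ^ 2 <= 2 * (Cmod f0 * (K * d ^ 3))).
{ apply (f_equal (Rmult eps)) in HZ. lra. }
assert (HF2 : 2 * eps <= Cmod f0 * K * d).
{ apply Rmult_le_reg_r with (2 * d ^ 2); [|lra]. generalize (pow_lt d 2 Hd); lra. }
apply Rle_div_r in Hd3; [|exact HT]. unfold T in Hd3.
assert (0 <= Cmod f0 * K * d) by (repeat apply Rmult_le_pos; lra).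
lra.
Qed.

(** The maximum of |f|^2 + eps |z|^2 over the closed disk lies on the circle,
    and eps is arbitrary. *)
Lemma maximum_principle (a : nat -> C) (f : C -> C) (r B : R) :
  power_series_on_disk a f -> 0 <= r < 1 ->
  (forall z, Cmod z = r -> Cmod (f z) <= B) ->
  forall z, Cmod z <= r -> Cmod (f z) <= B.
Proof.
intros Ha Hr HB z Hz.
assert (HB0 : 0 <= B).
{ apply Rle_trans with (2 := HB r ltac:(rewrite Cmod_R, Rabs_pos_eq; lra)). apply Cmod_ge_0. }
apply Rsqr_incr_0_var; [|exact HB0].
apply le_epsilon; intros eps Heps.
destruct (perturbed_modulus_Lipschitz a f r eps Ha Hr ltac:(lra)) as [K [HK HL]].
destruct (Lipschitz_max_annulus _ 0 r K ltac:(lra) HK HL) as [z0 [[_ Hz0] Hmax]].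
assert (Hmax' : forall w, Cmod w <= r ->
   Cmod (f w) ^ 2 + eps * Cmod w ^ 2 <= Cmod (f z0) ^ 2 + eps * Cmod z0 ^ 2).
{ intros w Hw; apply Hmax; split; [apply Cmod_ge_0|exact Hw]. }
destruct (Rle_lt_or_eq_dec _ _ Hz0) as [Hlt|Heq].
- exfalso; apply (perturbed_modulus_no_interior_max a f z0 r eps); auto; lra.
- specialize (Hmax' z Hz). specialize (HB z0 Heq).
  assert (P1 := Cmod_ge_0 (f z0)).
  assert (Cmod (f z0) ^ 2 <= B ^ 2) by (apply pow_incr; lra).
  assert (0 <= Cmod z ^ 2) by (apply pow_le, Cmod_ge_0).
  assert (Cmod z0 ^ 2 <= 1).
  { rewrite <- (pow1 2). apply pow_incr; generalize (Cmod_ge_0 z0); lra. }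
  assert (0 <= eps * Cmod z ^ 2) by (apply Rmult_le_pos; lra).
  assert (eps * Cmod z0 ^ 2 <= eps * 1) by (apply Rmult_le_compat_l; lra).
  unfold Rsqr. lra.
Qed.

(** * The bound |h' - 1| <= |z| *)

(** At a maximum of |f| over the closed disk |z| <= |z0|, the derivative of
    |f|^2 / 2 at z0 in a direction z0 d is Re (X d), with X = conj(f z0) z0 f'(z0).
    It is nonpositive for all d pointing into the disk, which leaves only
    X real and nonnegative. *)
Lemma boundary_max_derivative (f : C -> C) (z0 l : C) :
  has_Cderiv f z0 l -> z0 <> 0%C ->
  (forall z, Cmod z <= Cmod z0 -> Cmod (f z) <= Cmod (f z0)) ->
  Im (Cconj (f z0) * (z0 * l)) = 0 /\ 0 <= Re (Cconj (f z0) * (z0 * l)).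
Proof.
intros Hf Hz0 Hmax.
set (X := (Cconj (f z0) * (z0 * l))%C).
assert (Hr : 0 < Cmod z0) by (apply Cmod_gt_0, Hz0).
(* z0 (1 + s d) stays in the disk for small s > 0 whenever Re d < 0. *)
assert (Hdir : forall d : C, Re d < 0 -> Re (X * d) <= 0).
{ intros d Hd.
  assert (Hd0 : 0 < Cmod d).
  { apply Cmod_gt_0; intros ->; simpl in Hd; lra. }
  assert (Hf0 := Cmod_ge_0 (f z0)).
  apply le_epsilon; intros e He. rewrite Rplus_0_l.
  set (T := Cmod (f z0) * (Cmod z0 * Cmod d) + 1).
  assert (HT0 : 0 <= Cmod (f z0) * (Cmod z0 * Cmod d)) by (repeat apply Rmult_le_pos; lra).
  destruct (Hf (e / T)) as [del [Hdel Hder]].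
  { apply Rdiv_lt_0_compat; unfold T; lra. }
  set (s := Rmin (del / (2 * (Cmod z0 * Cmod d))) (- 2 * Re d / Cmod d ^ 2)).
  assert (Hzd : 0 < Cmod z0 * Cmod d) by (apply Rmult_lt_0_compat; lra).
  assert (Hs : 0 < s).
  { apply Rmin_pos; apply Rdiv_lt_0_compat; try lra. apply pow_lt; lra. }
  assert (Hs1 : s * (2 * (Cmod z0 * Cmod d)) <= del) by (apply Rle_div_r; [lra|apply Rmin_l]).
  assert (Hs2 : s * Cmod d ^ 2 <= - 2 * Re d) by (apply Rle_div_r; [apply pow_lt; lra|apply Rmin_r]).
  set (w := (z0 + s * (z0 * d))%C).
  assert (Hwz : (w - z0)%C = (s * (z0 * d))%C) by (unfold w; ring).
  assert (Hwzm : Cmod (w - z0) = s * (Cmod z0 * Cmod d)).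
  { rewrite Hwz, !Cmod_mult, Cmod_R, Rabs_pos_eq; lra. }
  assert (Hw : Cmod w <= Cmod z0).
  { replace w with (z0 * (1 + s * d))%C by (unfold w; ring).
    rewrite Cmod_mult.
    cut (Cmod (1 + s * d) <= 1); [intro H1; nra|].
    apply Rsqr_incr_0_var; [|lra]. rewrite !Rsqr_pow2, Cmod2_Re_Im.
    rewrite Cmod2_Re_Im in Hs2. destruct d as [d1 d2]; simpl in *. nra. }
  specialize (Hder w ltac:(rewrite Hwzm; lra)).
  rewrite Hwz in Hder at 1. rewrite Hwzm in Hder.
  specialize (Hmax w Hw).
  set (rho := (f w - f z0 - l * (s * (z0 * d)))%C) in *.
  assert (E : (Cconj (f z0) * f w = Cconj (f z0) * f z0 + s * (X * d) + Cconj (f z0) * rho)%C)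
    by (unfold X, rho; ring).
  apply (f_equal Re) in E. rewrite !re_plus, re_scal_l in E.
  assert (E2 : Re (Cconj (f z0) * f z0) = Cmod (f z0) ^ 2).
  { rewrite Cmod2_Re_Im. destruct (f z0); simpl; ring. }
  assert (E3 : Re (Cconj (f z0) * f w) <= Cmod (f z0) ^ 2).
  { apply Rle_trans with (1 := Rle_abs _). apply Rle_trans with (1 := re_le_Cmod _).
    rewrite Cmod_mult, Cmod_conj. simpl. rewrite Rmult_1_r. apply Rmult_le_compat_l; lra. }
  assert (E4 : - (Cmod (f z0) * Cmod rho) <= Re (Cconj (f z0) * rho)).
  { assert (H := re_le_Cmod (Cconj (f z0) * rho)). rewrite Cmod_mult, Cmod_conj in H.
    generalize (Rabs_maj2 (Re (Cconj (f z0) * rho))); lra. }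
  assert (E5 : Cmod (f z0) * Cmod rho <= Cmod (f z0) * (e / T * (s * (Cmod z0 * Cmod d))))
    by (apply Rmult_le_compat_l; auto).
  apply Rmult_le_reg_l with s; [exact Hs|].
  apply Rle_trans with (s * (e * ((Cmod (f z0) * (Cmod z0 * Cmod d)) / T))).
  - replace (s * (e * (Cmod (f z0) * (Cmod z0 * Cmod d) / T)))
      with (Cmod (f z0) * (e / T * (s * (Cmod z0 * Cmod d)))) by (field; unfold T; lra). lra.
  - apply Rmult_le_compat_l; [lra|]. rewrite <- (Rmult_1_r e) at 2.
    apply Rmult_le_compat_l; [lra|]. apply Rle_div_l; unfold T; lra. }
assert (HRe : 0 <= Re X).
{ assert (H := Hdir (-1 : C) ltac:(simpl; lra)). rewrite re_scal_r in H; lra. }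
split; [|exact HRe].
(* Directions d = - tau - i and d = - tau + i, with tau tending to 0,
   squeeze Im X from both sides. *)
assert (Htau : forall e, 0 < e -> Re X / (Re X + 1) * e <= e).
{ intros e He. rewrite <- (Rmult_1_l e) at 2. apply Rmult_le_compat_r; [lra|].
  apply Rle_div_l; lra. }
assert (Hplus : Im X <= 0).
{ apply le_epsilon; intros e He. specialize (Htau e He).
  assert (Hq : 0 < e / (Re X + 1)) by (apply Rdiv_lt_0_compat; lra).
  assert (H : Re (X * (- (e / (Re X + 1)), -1)%R)%C <= 0) by (apply Hdir; change (- (e / (Re X + 1)) < 0); lra).
  rewrite re_mult in H. change (Re X * - (e / (Re X + 1)) - Im X * -1 <= 0) in H.
  replace (Re X / (Re X + 1) * e) with (Re X * (e / (Re X + 1))) in Htau by (field; lra). lra. }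
assert (Hminus : - Im X <= 0).
{ apply le_epsilon; intros e He. specialize (Htau e He).
  assert (Hq : 0 < e / (Re X + 1)) by (apply Rdiv_lt_0_compat; lra).
  assert (H : Re (X * (- (e / (Re X + 1)), 1)%R) <= 0) by (apply Hdir; change (- (e / (Re X + 1)) < 0); lra).
  rewrite re_mult in H. change (Re X * - (e / (Re X + 1)) - Im X * 1 <= 0) in H.
  replace (Re X / (Re X + 1) * e) with (Re X * (e / (Re X + 1))) in Htau by (field; lra). lra. }
lra.
Qed.

(** Jack's lemma combined with the Schwarz lemma.  Let z0 maximize |phi| on the
    closed disk of radius r, |z0| = r, and let w = z0 phi(z0).  Then
    z0 phi'(z0) / phi(z0) is a real number y >= 0, so that
    z0 p'(z0) / p(z0) = - (1 + y) w / (1 - w), and |w| >= 1 would make its real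
    part at least 1 / 2. *)
Lemma log_derivative_Schwarz_bound (b : nat -> C) (phi p : C -> C) :
  power_series_on_disk b phi ->
  (forall z, Cmod z < 1 -> p z = (1 - z * phi z)%C) ->
  (forall z, Cmod z < 1 -> p z <> 0%C /\ Re (1 + z * C_derive p z / p z)%C < 3 / 2) ->
  forall z, Cmod z < 1 -> Cmod (phi z) <= 1.
Proof.
intros Hphi Hp Hre z Hz. assert (H0z := Cmod_ge_0 z).
assert (Hder := proj2 (power_series_derive b phi Hphi)).
assert (Hdp : forall w, Cmod w < 1 -> C_derive p w = (- (phi w + w * C_derive phi w))%C).
{ intros w Hw. apply has_Cderiv_unique.
  apply has_Cderiv_ext_disk with (fun w => 1 + (-(1)) * (w * phi w))%C; [exact Hw| |].
  - intros u Hu; rewrite (Hp u Hu); ring.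
  - replace (- (phi w + w * C_derive phi w))%C
      with (0 + (0 * (w * phi w) + (-(1)) * (1 * phi w + w * C_derive phi w)))%C by ring.
    apply has_Cderiv_plus; [apply has_Cderiv_const|].
    apply (has_Cderiv_mult (fun _ => (-(1))%C) (fun w => w * phi w)%C); [apply has_Cderiv_const|].
    apply (has_Cderiv_mult (fun w => w)); [apply has_Cderiv_id|apply Hder, Hw]. }
(* Only the bound 1 / r can be read off on the circle of radius r; the
   constant 1 is reached by letting r tend to 1. *)
assert (Hcirc : forall r, Cmod z < r < 1 -> r * Cmod (phi z) <= 1).
{ intros r Hr.
  destruct (perturbed_modulus_Lipschitz b phi r 0 Hphi ltac:(lra) ltac:(lra)) as [K [HK HL]].
  destruct (Lipschitz_max_annulus _ r r K ltac:(lra) HK HL) as [z0 [Hz0 Hmax]].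
  assert (Hz0r : Cmod z0 = r) by lra.
  assert (Hmax2 : forall w, Cmod w <= r -> Cmod (phi w) <= Cmod (phi z0)).
  { apply (maximum_principle b); [exact Hphi|lra|].
    intros w Hw. apply Rsqr_incr_0_var; [|apply Cmod_ge_0].
    specialize (Hmax w ltac:(lra)). rewrite !Rsqr_pow2. lra. }
  apply Rle_trans with (r * Cmod (phi z0)).
  { apply Rmult_le_compat_l; [lra|apply Hmax2; lra]. }
  apply Rnot_lt_le; intro Hbig.
  destruct (boundary_max_derivative phi z0 (C_derive phi z0)) as [HIm HRe].
  - apply Hder; lra.
  - intros ->; rewrite Cmod_0 in Hz0r; lra.
  - rewrite Hz0r; exact Hmax2.
  - destruct (Hre z0 ltac:(lra)) as [Hne Hlt].
    rewrite (Hdp z0 ltac:(lra)) in Hlt.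
    rewrite (Hp z0 ltac:(lra)) in Hne, Hlt.
    set (w := (z0 * phi z0)%C) in *. set (v := (z0 * C_derive phi z0)%C) in *.
    assert (Hw : 1 < Cmod w) by (unfold w; rewrite Cmod_mult, Hz0r; exact Hbig).
    set (x := Re (Cconj (phi z0) * v)) in *.
    assert (HX : (Cconj (phi z0) * v)%C = RtoC x).
    { apply injective_projections; [reflexivity|exact HIm]. }
    set (y := x / Cmod (phi z0) ^ 2).
    assert (Hphi0 : 0 < Cmod (phi z0)).
    { apply Rmult_lt_reg_l with r; lra. }
    assert (Hy : 0 <= y) by (apply Rdiv_le_0_compat; [exact HRe|apply pow_lt; lra]).
    assert (Hphin : phi z0 <> 0%C) by (apply Cmod_gt_0; lra).
    assert (Hcn : Cconj (phi z0) <> 0%C) by (apply Cmod_gt_0; rewrite Cmod_conj; lra).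
    assert (Hv : v = (y * phi z0)%C).
    { unfold y. rewrite RtoC_div by (apply pow_nonzero; lra). rewrite Cmod2_conj, <- HX. 
      field; split; assumption. }
    assert (HE : (1 + z0 * - (phi z0 + v) / (1 - w))%C = (1 - (1 + y) * (w / (1 - w)))%C).
    { rewrite Hv; unfold w; field. exact Hne. }
    rewrite HE in Hlt.
    assert (Hw2 : 1 < Cmod w ^ 2).
    { rewrite <- (pow1 2). simpl; nra. }
    rewrite Cmod2_Re_Im in Hw2.
    assert (HD : 0 < (1 - Re w) ^ 2 + Im w ^ 2).
    { assert (H := proj1 (Cmod_gt_0 _) Hne). apply (pow_lt _ 2) in H. rewrite Cmod2_alt in H.
      destruct w; simpl in *. lra. }
    (* w / (1 - w) maps the exterior of the unit disk into Re <= - 1 / 2. *)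
    assert (HR : Re (w / (1 - w)) <= - (1 / 2)).
    { replace (Re (w / (1 - w))) with
        ((Re w - (Re w * Re w + Im w * Im w)) / ((1 - Re w) ^ 2 + Im w ^ 2)).
      - apply Rle_div_l; [exact HD|]. nra.
      - destruct w as [a c]; simpl in *. field. repeat split; simpl in *; lra. }
    assert (HR2 : Re (1 - (1 + y) * (w / (1 - w))) = 1 - (1 + y) * Re (w / (1 - w))).
    { rewrite <- RtoC_plus. unfold Cminus. rewrite re_plus, re_opp, re_scal_l. simpl; ring. }
    rewrite HR2 in Hlt. nra. }
apply Rnot_lt_le; intro Hbig.
set (r := Rmax ((1 + Cmod z) / 2) ((1 + / Cmod (phi z)) / 2)).
assert (Hi : / Cmod (phi z) < 1) by (rewrite <- Rinv_1; apply Rinv_lt_contravar; lra).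
assert (H1 : (1 + Cmod z) / 2 <= r) by apply Rmax_l.
assert (H2 : (1 + / Cmod (phi z)) / 2 <= r) by apply Rmax_r.
assert (H3 : r < 1) by (apply Rmax_lub_lt; lra).
specialize (Hcirc r ltac:(lra)).
assert (H4 : / Cmod (phi z) * Cmod (phi z) = 1) by (apply Rinv_l; lra).
nra.
Qed.

(** For every map in the class, 1 - h' obeys the Schwarz bound, exactly as
    the extremal h' = 1 - z does. *)
Lemma class_F_derivative_near_1 (alpha : R) (lambda : C) (n : nat) (h g : C -> C) (f : C -> C) :
  alpha <= 3 / 2 -> class_H f h g ->
  (forall z : C, in_disk z ->
      C_derive h z <> RtoC 0 /\
      Re (1 + z * C_derive (C_derive h) z / C_derive h z)%C < alpha /\
      C_derive g z = (lambda * z ^ n * C_derive h z)%C) ->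
  forall z, Cmod z < 1 -> Cmod (1 - C_derive h z) <= Cmod z.
Proof.
intros Halpha (_ & _ & _ & _ & Hd1 & a & b & Hs) HF.
set (A := fun k : nat => match k return C with O => 0%C | S O => 1%C | _ => a k end).
assert (HA : power_series_on_disk A h).
{ intros z Hz.
  assert (H := proj1 (Hs z Hz)).
  apply (is_series_decr_n (V := C_NormedModule) _ 2 _); [lia|].
  replace (plus (h z) _) with (h z - z)%C.
  - apply (is_series_ext (fun k : nat => (a (k + 2)%nat * z ^ (k + 2))%C)); [|exact H].
    intro k. replace (k + 2)%nat with (2 + k)%nat by lia. reflexivity.
  - simpl. rewrite sum_Sn, sum_O. unfold opp, plus; simpl. ring_in_C. }
destruct (power_series_derive A h HA) as [HB _].
(* phi is (1 - h') / z with its removable singularity filled in. *)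
set (phi := fun z => if Ceq_dec z 0 then (- (INR 2 * A 2%nat))%C else ((1 - C_derive h z) / z)%C).
set (b' := fun k => (- (INR (S (S k)) * A (S (S k))))%C).
assert (Hp : forall z, Cmod z < 1 -> C_derive h z = (1 - z * phi z)%C).
{ intros z Hz. unfold phi. destruct (Ceq_dec z 0) as [->|Hn].
  - rewrite Hd1; ring.
  - field; exact Hn. }
assert (Hphi : power_series_on_disk b' phi).
{ intros z Hz. unfold phi. destruct (Ceq_dec z 0) as [->|Hn].
  - replace (- (INR 2 * A 2%nat))%C with (b' O * 0 ^ O)%C by (unfold b'; simpl Cpow; ring).
    apply (is_series_single (fun k => (b' k * 0 ^ k)%C)).
    intros [|k] Hk; [lia|]. rewrite Cpow_S; ring.
  - specialize (HB z Hz).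
    apply (is_series_ext (fun k => ((- / z) * (INR (S (S k)) * A (S (S k)) * z ^ S k))%C)).
    + intro k. unfold b'. rewrite Cpow_S.
      match goal with |- ?x = ?y => change (@eq C x y) end. field; exact Hn.
    + replace ((1 - C_derive h z) / z)%C with ((- / z) * (C_derive h z - 1))%C by (field; exact Hn).
      apply (is_series_scal (V := C_NormedModule) (- / z)%C).
      apply (is_series_incr_n (V := C_NormedModule) (fun k => (INR (S k) * A (S k) * z ^ k)%C) 1); [lia|].
      simpl Init.Nat.pred. rewrite sum_O.
      replace (plus _ _) with (C_derive h z); [exact HB|].
      simpl. unfold plus; simpl. ring_in_C. }
intros z Hz. rewrite (Hp z Hz).
replace (1 - (1 - z * phi z))%C with (z * phi z)%C by ring.
rewrite Cmod_mult. rewrite <- (Rmult_1_r (Cmod z)) at 2.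
apply Rmult_le_compat_l; [apply Cmod_ge_0|].
apply (log_derivative_Schwarz_bound b' phi (C_derive h)); auto.
intros w Hw. destruct (HF w Hw) as (H1 & H2 & _). split; [exact H1|lra].
Qed.

(** * Derivatives along a ray *)

Lemma derive_ge_compare (u v du dv : R -> R) (r : R) :
  0 <= r ->
  (forall t, 0 <= t <= r -> is_derive u t (du t)) ->
  (forall t, 0 <= t <= r -> is_derive v t (dv t)) ->
  (forall t, 0 <= t <= r -> du t <= dv t) ->
  u r - u 0 <= v r - v 0.
Proof.
intros Hr Hu Hv Hle.
assert (Hd : forall t, 0 <= t <= r -> is_derive (fun t => v t - u t) t (dv t - du t)).
{ intros t Ht. apply (is_derive_minus (V := R_NormedModule)); auto. }
destruct (MVT_gen (fun t => v t - u t) 0 r (fun t => dv t - du t)) as [c [Hc E]].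
- intros t; rewrite Rmin_left, Rmax_right by lra; intro Ht; apply Hd; lra.
- intros t; rewrite Rmin_left, Rmax_right by lra; intro Ht.
  apply derivable_continuous_pt. exists (dv t - du t). apply is_derive_Reals, Hd, Ht.
- rewrite Rmin_left, Rmax_right in Hc by lra. specialize (Hle c Hc).
  assert (0 <= (dv c - du c) * (r - 0)) by (apply Rmult_le_pos; lra). lra.
Qed.

(** Antiderivative, vanishing at 0, of
    A + B t + D t^n + G t^(n+1) + H t^(2n+1): all the bounds for the derivative
    of f along a ray have this form. *)
Definition ray_poly (n : nat) (A B D G H : R) (t : R) : R :=
  A * t + B * (t ^ 2 / 2) + D * (t ^ (n + 1) / (INR n + 1)) + G * (t ^ (n + 2) / (INR n + 2))
  + H * (t ^ (2 * n + 2) / (2 * INR n + 2)).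

Lemma ray_poly_0 (n : nat) (A B D G H : R) : ray_poly n A B D G H 0 = 0.
Proof.
unfold ray_poly. rewrite (pow_i (n + 1)), (pow_i (n + 2)), (pow_i (2 * n + 2)) by lia.
unfold Rdiv; simpl; ring.
Qed.

Lemma is_derive_ray_poly (n : nat) (A B D G H t : R) :
  is_derive (ray_poly n A B D G H) t
    (A + B * t + D * t ^ n + G * t ^ (n + 1) + H * t ^ (2 * n + 1)).
Proof.
unfold ray_poly. assert (Hn := pos_INR n).
auto_derive; [auto|].
replace (Init.Nat.pred (n + 1)) with n by lia.
replace (Init.Nat.pred (n + 2)) with (n + 1)%nat by lia.
replace (Init.Nat.pred (n + (n + 0) + 2)) with (2 * n + 1)%nat by lia.
replace (n + (n + 0) + 2)%nat with (2 * n + 2)%nat by lia.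
rewrite !plus_INR, mult_INR. simpl (INR 1). simpl (INR 2). 
field; lra.
Qed.

Lemma growth_upper_poly (lambda : C) (n : nat) (r : R) :
  growth_upper lambda n r = ray_poly n 1 1 (Cmod lambda) (Cmod lambda) 0 r.
Proof.
unfold growth_upper, ray_poly. rewrite !pow_add. assert (H := pos_INR n). 
simpl (r ^ 1). simpl (r ^ 2). field; lra.
Qed.

Lemma growth_lower_poly (lambda : C) (n : nat) (r : R) :
  growth_lower lambda n r = ray_poly n 1 (-1) (- Cmod lambda) (Cmod lambda) 0 r.
Proof.
unfold growth_lower, ray_poly. rewrite !pow_add. assert (H := pos_INR n).
simpl (r ^ 1). simpl (r ^ 2). field; lra.
Qed.

Lemma is_derive_ray (F : C -> C) (zeta c l : C) (t : R) :
  has_Cderiv F (t * zeta)%C l ->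
  is_derive (fun s : R => Re (c * F (s * zeta)%C)) t (Re (c * (zeta * l))).
Proof.
intro HF. split; [apply is_linear_scal_l|].
intros y Hy. assert (Hyt : y = t) by (symmetry; apply is_filter_lim_locally_unique; exact Hy).
subst y. intros [eps He].
set (T := Cmod c * Cmod zeta + 1).
assert (Hc := Cmod_ge_0 c). assert (Hz := Cmod_ge_0 zeta).
assert (Hcz : 0 <= Cmod c * Cmod zeta) by (apply Rmult_le_pos; auto).
destruct (HF (eps / T)) as [d [Hd Hder]]; [apply Rdiv_lt_0_compat; unfold T; lra|].
assert (Hd' : 0 < d / (Cmod zeta + 1)) by (apply Rdiv_lt_0_compat; lra).
exists (mkposreal _ Hd'). intros s Hs. change (Rabs (s - t) < d / (Cmod zeta + 1)) in Hs.
simpl. unfold minus, scal, plus, opp, norm; simpl. unfold mult, abs; simpl.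
fold (Rminus s t).
assert (E : (s * zeta - t * zeta)%C = (RtoC (s - t) * zeta)%C) by (rewrite RtoC_minus; ring).
assert (Hst : Cmod (s * zeta - t * zeta) = Rabs (s - t) * Cmod zeta)
  by (rewrite E, Cmod_mult, Cmod_R; ring).
apply Rlt_div_r in Hs; [|lra].
assert (H0 := Rabs_pos (s - t)).
specialize (Hder (s * zeta)%C ltac:(rewrite Hst; lra)).
rewrite Hst in Hder.
match goal with |- Rabs ?X <= _ =>
  replace X with (Re (c * (F (s * zeta) - F (t * zeta) - l * (s * zeta - t * zeta)))%C) end.
- apply Rle_trans with (1 := re_le_Cmod _). rewrite Cmod_mult.
  apply Rle_trans with (Cmod c * (eps / T * (Rabs (s - t) * Cmod zeta))).
  + apply Rmult_le_compat_l; auto.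
  + replace (Cmod c * (eps / T * (Rabs (s - t) * Cmod zeta)))
      with (eps * Rabs (s - t) * ((Cmod c * Cmod zeta) / T)) by (field; unfold T; lra).
    rewrite <- (Rmult_1_r (eps * _)) at 2. apply Rmult_le_compat_l; [apply Rmult_le_pos; lra|].
    apply Rle_div_l; unfold T; lra.
- rewrite E.
  replace (c * (F (s * zeta) - F (t * zeta) - l * (RtoC (s - t) * zeta)))%C
    with (c * F (s * zeta) - c * F (t * zeta) - RtoC (s - t) * (c * (zeta * l)))%C by ring.
  unfold Cminus. rewrite !re_plus, !re_opp, re_scal_l. unfold Re; simpl; ring.
Qed.

(** Differentiation of Re (e conj(zeta) f(t zeta)) in t.  Only the
    derivative p of the analytic part is involved, because g' = lambda z^n h'. *)
Lemma class_F_ray (alpha : R) (lambda : C) (n : nat) (f : C -> C) :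
  alpha <= 3 / 2 -> class_F alpha lambda n f ->
  exists p : C -> C,
    (forall z, Cmod z < 1 -> Cmod (1 - p z) <= Cmod z) /\
    forall zeta e : C, Cmod zeta = 1 -> exists u : R -> R,
      u 0 = 0 /\
      (forall t, 0 <= t < 1 -> u t = Re (e * (Cconj zeta * f (t * zeta)))%C) /\
      (forall t, 0 <= t < 1 -> is_derive u t
        (Re ((e + Cconj e * (lambda * zeta ^ (n + 2)) * t ^ n) * p (t * zeta))%C)).
Proof.
intros Halpha (h & g & Hclass & HF).
assert (Hbound := class_F_derivative_near_1 alpha lambda n h g f Halpha Hclass HF).
exists (C_derive h); split; [exact Hbound|].
intros zeta e Hzeta.
destruct Hclass as (Hh & Hg & Hf & Hf0 & _).
assert (Hdisk : forall t, 0 <= t < 1 -> Cmod (t * zeta) < 1).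
{ intros t Ht. rewrite Cmod_mult, Hzeta, Cmod_R, Rabs_pos_eq; lra. }
set (c := (e * Cconj zeta)%C).
(* Moving the conjugation from g to c leaves only complex derivatives. *)
set (u := fun t : R => Re (c * h (t * zeta)%C) + Re (Cconj c * g (t * zeta)%C)).
assert (Hu : forall t, 0 <= t < 1 -> u t = Re (e * (Cconj zeta * f (t * zeta)))%C).
{ intros t Ht. rewrite (Hf _ (Hdisk t Ht)). unfold u, c.
  rewrite Cmult_conj, Cconj_conj.
  rewrite <- (re_conj (_ * g _)), !Cmult_conj, Cconj_conj, <- re_plus. f_equal. ring. }
exists u; split; [|split; [exact Hu|]].
- rewrite Hu by lra. replace (0 * zeta)%C with (0 : C) by ring. rewrite Hf0, !Cmult_0_r. reflexivity.
- intros t Ht.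
  replace (Re _) with (Re (c * (zeta * C_derive h (t * zeta))) +
     Re (Cconj c * (zeta * C_derive g (t * zeta)))).
  + apply (is_derive_plus (V := R_NormedModule));
      apply is_derive_ray, is_derive_has_Cderiv, C_derive_correct; auto; apply Hh || apply Hg; apply Hdisk; exact Ht.
  + destruct (HF _ (Hdisk t Ht)) as (_ & _ & ->).
    rewrite <- re_plus. f_equal. unfold c.
    rewrite Cmult_conj, Cconj_conj, Cpow_mult_l, Cpow_add_r. simpl (zeta ^ 2)%C.
    replace (e * Cconj zeta * (zeta * C_derive h (t * zeta)))%C
      with (e * (zeta * Cconj zeta) * C_derive h (t * zeta))%C by ring.
    rewrite Cmult_conj_unit by exact Hzeta. ring.
Qed.

(** * The upper growth bound *)

Lemma rotation_to_modulus (w : C) : exists e : C, Cmod e = 1 /\ Re (e * w) = Cmod w.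
Proof.
destruct (unit_polar w) as [u [Hu E]].
exists (Cconj u); split; [rewrite Cmod_conj; exact Hu|].
rewrite E at 1. replace (Cconj u * (Cmod w * u))%C with (Cmod w * (u * Cconj u))%C by ring.
rewrite Cmult_conj_unit by exact Hu. rewrite Cmult_1_r. reflexivity.
Qed.

(** Take for e the unit number that turns conj(zeta) f(z) into its modulus: the
    derivative along the ray is at most (1 + |lambda| t^n) (1 + t). *)
Lemma class_F_upper (alpha : R) (lambda : C) (n : nat) (f : C -> C) (z : C) :
  alpha <= 3 / 2 -> class_F alpha lambda n f -> Cmod z < 1 ->
  Cmod (f z) <= growth_upper lambda n (Cmod z).
Proof.
intros Halpha HF Hz. assert (Hr := Cmod_ge_0 z). set (r := Cmod z) in *.
destruct (class_F_ray alpha lambda n f Halpha HF) as (p & Hp & Hray).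
destruct (unit_polar z) as [zeta [Hzeta Ez]]. fold r in Ez.
destruct (rotation_to_modulus (Cconj zeta * f z)) as [e [He Hmod]].
destruct (Hray zeta e Hzeta) as (u & Hu0 & Hu & Hdu).
rewrite Cmod_mult, Cmod_conj, Hzeta, Rmult_1_l in Hmod.
rewrite growth_upper_poly, <- Hmod.
replace (Re (e * (Cconj zeta * f z))) with (u r - u 0) by (rewrite Hu0, Hu, <- Ez by lra; ring).
set (m := Cmod lambda). assert (Hm : 0 <= m) by apply Cmod_ge_0.
apply Rle_trans with (ray_poly n 1 1 m m 0 r - ray_poly n 1 1 m m 0 0);
  [|rewrite ray_poly_0; lra].
apply (derive_ge_compare u (ray_poly n 1 1 m m 0) 
   (fun t => Re ((e + Cconj e * (lambda * zeta ^ (n + 2)) * t ^ n) * p (t * zeta))%C)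
   (fun t => 1 + 1 * t + m * t ^ n + m * t ^ (n + 1) + 0 * t ^ (2 * n + 1))); try assumption.
- intros t Ht; apply Hdu; lra.
- intros t Ht; apply is_derive_ray_poly.
- intros t Ht. apply Rle_trans with (1 := Rle_abs _), Rle_trans with (1 := re_le_Cmod _).
  rewrite Cmod_mult.
  assert (Htz : Cmod (t * zeta) = t) by (rewrite Cmod_mult, Hzeta, Cmod_R, Rabs_pos_eq; lra).
  assert (H1 : Cmod (e + Cconj e * (lambda * zeta ^ (n + 2)) * t ^ n) <= 1 + m * t ^ n).
  { apply Rle_trans with (1 := Cmod_triangle _ _).
    rewrite !Cmod_mult, Cmod_conj, He, !Cmod_pow, Hzeta, pow1, Cmod_R, Rabs_pos_eq by lra.
    unfold m; lra. }
  assert (H2 : Cmod (p (t * zeta)%C) <= 1 + t).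
  { replace (p (t * zeta)%C) with (1 + - (1 - p (t * zeta)))%C by ring.
    apply Rle_trans with (1 := Cmod_triangle _ _). rewrite Cmod_1, Cmod_opp.
    specialize (Hp (t * zeta)%C ltac:(lra)). lra. }
  apply Rle_trans with ((1 + m * t ^ n) * (1 + t)).
  + apply Rmult_le_compat; auto using Cmod_ge_0.
  + rewrite pow_add. simpl. lra.
Qed.

(** * The lower growth bound *)

(** The left-hand side is the modulus of the image of the unit vector (c, d)
    under diag (1 - s, 1 + s).  With q = d^2 it is a concave function of q; the
    chord 1 - s + 2 s q is exact at q = 0 and q = 1, and the last term bounds
    the deviation from it.  The factor K is a bound for 1 / (1 - s). *)
Lemma ellipse_radius_le (s K c d : R) :
  0 <= s -> s <= 1 -> 1 <= K * (1 - s) -> c ^ 2 + d ^ 2 = 1 ->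
  sqrt (((1 - s) * c) ^ 2 + ((1 + s) * d) ^ 2)
  <= 1 - s + 2 * s * d ^ 2 + 2 * K * s ^ 2 * (d ^ 2 * (1 - d ^ 2)).
Proof.
intros Hs Hs1 HK Hcd.
assert (HK0 : 0 <= K) by nra.
set (q := d ^ 2) in *.
assert (Hq : 0 <= q) by apply pow2_ge_0.
assert (Hq1 : 0 <= 1 - q) by (generalize (pow2_ge_0 c); lra).
assert (Hqq : 0 <= q * (1 - q)) by (apply Rmult_le_pos; auto).
set (Q := s ^ 2 * (q * (1 - q))).
assert (HQ : 0 <= Q) by (apply Rmult_le_pos; [apply pow2_ge_0|exact Hqq]).
set (a := 1 - s + 2 * s * q).
assert (Hsq : 0 <= s * q) by (apply Rmult_le_pos; auto).
assert (Ha : 0 <= a) by (unfold a; lra).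
assert (HaK : 1 <= a * K).
{ unfold a. assert (0 <= s * q * K) by (apply Rmult_le_pos; auto). lra. }
replace (a + 2 * K * s ^ 2 * (q * (1 - q))) with (a + 2 * K * Q) by (unfold Q; ring).
assert (H0 : 0 <= K * Q) by (apply Rmult_le_pos; auto).
apply Rsqr_incr_0_var; [|lra].
rewrite Rsqr_sqrt by (apply Rplus_le_le_0_compat; apply pow2_ge_0).
replace (((1 - s) * c) ^ 2 + ((1 + s) * d) ^ 2) with (a ^ 2 + 4 * Q).
- unfold Rsqr. assert (0 <= (a * K - 1) * Q) by (apply Rmult_le_pos; lra).
  assert (0 <= (K * Q) * (K * Q)) by (apply Rmult_le_pos; lra).
  lra.
- unfold Q, a. replace (((1 - s) * c) ^ 2) with ((1 - s) ^ 2 * (1 - q)) by (replace (1 - q) with (c ^ 2) by lra; ring).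
  unfold q; ring.
Qed.

(** The integrated lower bound, minus the growth bound.  Here N is the integer n,
    rn is r^n, and (x, -y) is nu, a square root of minus the unit number
    lambda zeta^(n+2) / |lambda|.

    In the direction (c, d) = (x, y) the inequality reduces to
    2 / (N + 1) - 2 r / (N + 2) >= m r^(n+1) (1 - y^2) / N, which holds for
    N >= 2.  For N = 1 it may fail when y is small and m r is close to 1 / 2;
    then the direction with d = 4 y / 5 works. *)
Lemma direction_for_lower_bound (N m r rn x y : R) :
  (N = 1 /\ rn = r \/ 2 <= N) -> 0 <= m -> m * (N + 1) <= 1 -> 0 <= r <= 1 -> 0 <= rn <= 1 ->
  0 <= x -> x ^ 2 + y ^ 2 = 1 ->
  exists c d, c ^ 2 + d ^ 2 = 1 /\
    0 <= (r - m * (r * rn) / (N + 1)) * (c * x + d * y - 1)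
         + 2 * (m * (r * rn) / (N + 1)) * (d * y)
         - 2 * (m * (r * r * rn) / (N + 2)) * d ^ 2
         - (m ^ 2 * (r * rn) ^ 2 / N) * (d ^ 2 * (1 - d ^ 2)).
Proof.
intros HN Hm Hm1 Hr Hrn Hx Hxy.
assert (Hy2 : 0 <= y ^ 2) by apply pow2_ge_0.
assert (Hx2 : 0 <= x ^ 2) by apply pow2_ge_0.
destruct HN as [[-> ->]|HN].
- set (sg := m * r).
  assert (Hsg : 0 <= sg <= 1 / 2) by (unfold sg; split; nra).
  destruct (Rle_lt_dec (sg * (1 - y ^ 2)) (1 / 3)) as [Hle|Hgt].
  + exists x, y; split; [exact Hxy|].
    replace (_ - _) with (sg * r * y ^ 2 * (1 - 2 / 3 * r - r * (sg * (1 - y ^ 2)))).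
    * assert (0 <= r * (1 / 3 - sg * (1 - y ^ 2))) by (apply Rmult_le_pos; lra).
      apply Rmult_le_pos; [apply Rmult_le_pos; [apply Rmult_le_pos|]; lra|lra].
    * replace (x * x + y * y - 1) with 0 by (simpl in Hxy; lra). unfold sg; field.
  + assert (Hy3 : y ^ 2 <= 1 / 3) by nra.
    set (Y := y ^ 2) in *.
    (* Tilting the direction towards the real axis costs 1 - c x - d y, which
       is about (1 - 4 / 5)^2 y^2 / 2 and at most 28 / 1000 y^2, whereas the
       error terms in d^2 shrink by the factor 16 / 25. *)
    exists (sqrt (1 - (4 / 5 * y) ^ 2)), (4 / 5 * y).
    replace ((4 / 5 * y) ^ 2) with (16 / 25 * Y) by (unfold Y; field).
    assert (Hs : 0 <= 1 - 16 / 25 * Y) by lra.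
    split; [rewrite <- Rsqr_pow2, Rsqr_sqrt; lra|].
    assert (Hcx : 1 - 4 / 5 * Y - 28 / 1000 * Y <= sqrt (1 - 16 / 25 * Y) * x).
    { apply Rsqr_incr_0_var; [|apply Rmult_le_pos; [apply sqrt_pos|exact Hx]].
      rewrite Rsqr_mult, Rsqr_sqrt, (Rsqr_pow2 x) by exact Hs.
      replace (x ^ 2) with (1 - Y) by lra. unfold Rsqr. nra. }
    set (u := sqrt (1 - 16 / 25 * Y) * x) in *.
    replace (4 / 5 * y * y) with (4 / 5 * Y) by (unfold Y; ring).
    apply Rle_trans with (r * Y * (- (28 / 1000) * (1 - sg / 2) + 4 / 5 * sg
       - 2 / 3 * (16 / 25) * sg * r - 16 / 25 * sg ^ 2 * r * (1 - 16 / 25 * Y))).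
    * apply Rmult_le_pos; [apply Rmult_le_pos; lra|].
      assert (sg * r <= sg) by nra.
      assert (Hv : sg ^ 2 * r * (1 - 16 / 25 * Y) <= sg ^ 2).
      { rewrite <- (Rmult_1_r (sg ^ 2)) at 2. rewrite Rmult_assoc. apply Rmult_le_compat_l; [apply pow2_ge_0|]. nra. }
      assert (1 / 3 <= sg) by nra.
      assert (0 <= (sg - 1 / 3) * (1 / 2 - sg)) by (apply Rmult_le_pos; lra).
      lra.
    * assert (HM : 0 <= r - m * (r * r) / (1 + 1)).
      { replace (r - m * (r * r) / (1 + 1)) with (r * (1 - sg / 2)) by (unfold sg; field).
        apply Rmult_le_pos; lra. }
      apply (Rmult_le_compat_l _ _ _ HM) in Hcx.
      assert (E : r * Y *
       (- (28 / 1000) * (1 - sg / 2) + 4 / 5 * sg - 2 / 3 * (16 / 25) * sg * r -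
        16 / 25 * sg ^ 2 * r * (1 - 16 / 25 * Y))
        = (r - m * (r * r) / (1 + 1)) * (1 - 4 / 5 * Y - 28 / 1000 * Y)
          + (r - m * (r * r) / (1 + 1)) * (4 / 5 * Y - 1)
          + 2 * (m * (r * r) / (1 + 1)) * (4 / 5 * Y) -
    2 * (m * (r * r * r) / (1 + 2)) * (16 / 25 * Y) -
    m ^ 2 * (r * r) ^ 2 / 1 * (16 / 25 * Y * (1 - 16 / 25 * Y))) by (unfold sg; field).
      rewrite E. lra.
- exists x, y; split; [exact Hxy|].
  replace (x * x + y * y - 1) with 0 by (simpl in Hxy; lra).
  set (R0 := r * rn). assert (HR0 : 0 <= R0 <= 1) by (unfold R0; nra).
  replace (_ - _) with (m * R0 * y ^ 2 * (2 / (N + 1) - 2 * r / (N + 2) - m * R0 * (1 - y ^ 2) / N)).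
  + apply Rmult_le_pos; [apply Rmult_le_pos; [apply Rmult_le_pos|]; lra|].
    assert (H1 : 2 * r / (N + 2) <= 2 / (N + 2)).
    { apply Rmult_le_compat_r; [|lra]. apply Rlt_le, Rinv_0_lt_compat; lra. }
    assert (H2 : m * R0 * (1 - y ^ 2) / N <= 1 / (N * (N + 1))).
    { apply Rle_div_l; [lra|].
      replace (1 / (N * (N + 1)) * N) with (1 / (N + 1)) by (field; lra).
      apply Rmult_le_reg_r with (N + 1); [lra|].
      replace (1 / (N + 1) * (N + 1)) with 1 by (field; lra).
      assert (0 <= R0 * (1 - y ^ 2) <= 1) by nra.
      replace (m * R0 * (1 - y ^ 2) * (N + 1)) with (m * (N + 1) * (R0 * (1 - y ^ 2))) by ring.
      assert (0 <= m * (N + 1)) by (apply Rmult_le_pos; lra). nra. }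
    assert (H3 : 0 <= 2 / (N + 1) - 2 / (N + 2) - 1 / (N * (N + 1))).
    { replace (_ - _) with ((N - 2) / (N * (N + 1) * (N + 2))) by (field; lra).
      apply Rdiv_le_0_compat; [lra|]. repeat apply Rmult_lt_0_compat; lra. }
    lra.
  + unfold R0; field; lra.
Qed.

Lemma unit_square_coordinates (w : C) : Cmod w = 1 ->
  exists x y : R, 0 <= x /\ x ^ 2 + y ^ 2 = 1 /\ w = ((x, - y)%R ^ 2)%C.
Proof.
intro Hw. destruct (unit_root_exists w 1 Hw) as [[x y] [Hv E]].
assert (H := Cmod2_alt (x, y)). rewrite Hv in H. simpl in H.
destruct (Rle_lt_dec 0 x) as [Hx|Hx].
- exists x, (- y); repeat split; [exact Hx|simpl; lra|]. rewrite <- E, Ropp_involutive. reflexivity.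
- exists (- x), y; repeat split; [lra|simpl; lra|]. rewrite <- E.
  replace ((- x, - y)%R : C) with (- ((x, y)%R : C))%C by reflexivity. ring.
Qed.

(** Along the ray, h' = 1 - v with |v| <= t, and in the direction e = nu (c + i d)
    the derivative of the real part is Re (nu W (1 - v)) with
    W = ((1 - s) c, (1 + s) d) and s = |lambda| t^n; the worst v costs t |W|. *)
Lemma class_F_lower (alpha : R) (lambda : C) (n : nat) (f : C -> C) (z : C) :
  (1 <= n)%nat -> Cmod lambda <= 1 / (INR n + 1) ->
  alpha <= 3 / 2 -> class_F alpha lambda n f -> Cmod z < 1 ->
  growth_lower lambda n (Cmod z) <= Cmod (f z).
Proof.
intros Hn Hlam Halpha HF Hz. assert (Hr := Cmod_ge_0 z). set (r := Cmod z) in *.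
assert (HN : 1 <= INR n) by (apply (le_INR 1), Hn).
destruct (class_F_ray alpha lambda n f Halpha HF) as (p & Hp & Hray).
destruct (unit_polar z) as [zeta [Hzeta Ez]]. fold r in Ez.
set (m := Cmod lambda). assert (Hm : 0 <= m) by apply Cmod_ge_0.
assert (Hm1 : m * (INR n + 1) <= 1).
{ apply (Rmult_le_compat_r (INR n + 1)) in Hlam; [|lra]. fold m in Hlam.
  replace (1 / (INR n + 1) * (INR n + 1)) with 1 in Hlam by (field; lra). exact Hlam. }
destruct (unit_polar lambda) as [om [Hom Elam]]. fold m in Elam.
destruct (unit_square_coordinates (- (om * zeta ^ (n + 2)))) as (x & y & Hx & Hxy & Exy).
{ rewrite Cmod_opp, Cmod_mult, Cmod_pow, Hom, Hzeta, pow1; ring. }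
set (nu := (x, - y) : C) in *.
assert (Enu : (lambda * zeta ^ (n + 2))%C = (- (m * nu ^ 2))%C).
{ rewrite Elam, <- Exy; ring. }
destruct (direction_for_lower_bound (INR n) m r (r ^ n) x y) as (c & d & Hcd & Hmain); auto.
{ destruct (Nat.eq_dec n 1) as [->|]; [left; simpl; split; ring|right].
  apply (le_INR 2); lia. }
{ lra. }
{ split; [apply pow_le; lra|]. rewrite <- (pow1 n); apply pow_incr; lra. }
set (delta := (c, d) : C). set (e := (nu * delta)%C).
assert (Hnu : Cmod nu = 1).
{ apply Rsqr_inj; [apply Cmod_ge_0|lra|]. rewrite !Rsqr_pow2, Cmod2_alt. simpl in *; lra. }
assert (Hdelta : Cmod delta = 1).
{ apply Rsqr_inj; [apply Cmod_ge_0|lra|]. rewrite !Rsqr_pow2, Cmod2_alt. simpl in *; lra. }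
assert (He : Cmod e = 1) by (unfold e; rewrite Cmod_mult, Hnu, Hdelta; ring).
destruct (Hray zeta e Hzeta) as (u & Hu0 & Hu & Hdu).
apply Rle_trans with (u r - u 0).
2: { rewrite Hu0, Hu, <- Ez, Rminus_0_r by lra.
  apply Rle_trans with (1 := Rle_abs _), Rle_trans with (1 := re_le_Cmod _).
  rewrite !Cmod_mult, He, Cmod_conj, Hzeta. lra. }
rewrite growth_lower_poly.
set (K := (INR n + 1) / INR n).
set (q := d ^ 2 * (1 - d ^ 2)).
set (P := ray_poly n (c * x + d * y) (-1) (m * (d * y - c * x)) (m * (1 - 2 * d ^ 2)) (- (2 * K * m ^ 2 * q))).
apply Rle_trans with (P r - P 0).
- unfold P. rewrite ray_poly_0. unfold ray_poly.
  fold m. unfold q, K in *. 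
  replace (2 * n + 2)%nat with (1 + n + (1 + n))%nat by lia.
  replace (n + 1)%nat with (1 + n)%nat by lia.
  replace (n + 2)%nat with (1 + (1 + n))%nat by lia.
  rewrite !pow_add. simpl (r ^ 1). rewrite !Rmult_1_r.
  assert (E1 : forall X Y Z T : R, X <= Y - 0 <-> 0 <= Y - X) by (intros; lra).
  apply (E1 _ _ 0 0). refine (Rle_trans _ _ _ Hmain (Req_le _ _ _)).
  field. lra.
- apply (derive_ge_compare P u 
   (fun t => (c * x + d * y) + (-1) * t + (m * (d * y - c * x)) * t ^ n
       + (m * (1 - 2 * d ^ 2)) * t ^ (n + 1) + (- (2 * K * m ^ 2 * q)) * t ^ (2 * n + 1))
   (fun t => Re ((e + Cconj e * (lambda * zeta ^ (n + 2)) * t ^ n) * p (t * zeta))%C)); try assumption.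
  + intros t Ht; apply is_derive_ray_poly.
  + intros t Ht; apply Hdu; lra.
  + intros t Ht.
    set (s := m * t ^ n).
    assert (Htn : 0 <= t ^ n <= 1).
    { split; [apply pow_le; lra|]. rewrite <- (pow1 n); apply pow_incr; lra. }
    assert (Hs : 0 <= s <= m).
    { unfold s; split; [apply Rmult_le_pos; lra|].
      rewrite <- (Rmult_1_r m) at 2. apply Rmult_le_compat_l; lra. }
    assert (HK : 1 <= K * (1 - s)).
    { unfold K. replace ((INR n + 1) / INR n * (1 - s)) with ((INR n + 1) * (1 - s) / INR n) by (field; lra).
      apply Rle_div_r; nra. }
    (* In the frame of nu, conjugation acts as a reflection: multiplication by
       1 - s on one axis and by 1 + s on the other. *)
    assert (Ew : (e + Cconj e * (lambda * zeta ^ (n + 2)) * t ^ n)%C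
                 = (nu * ((1 - s) * c, (1 + s) * d)%R)%C).
    { rewrite Enu. unfold e. rewrite Cmult_conj.
      replace (nu * delta + Cconj nu * Cconj delta * - (m * nu ^ 2) * t ^ n)%C
        with (nu * (delta - (nu * Cconj nu) * (m * t ^ n) * Cconj delta))%C by ring.
      rewrite Cmult_conj_unit by exact Hnu. f_equal.
      rewrite <- RtoC_pow, Cmult_1_l, <- RtoC_mult. fold s.
      unfold delta, Cconj, Cminus, Cplus, Copp, Cmult, RtoC; simpl; f_equal; ring. }
    rewrite Ew.
    set (W := ((1 - s) * c, (1 + s) * d)%R : C).
    assert (HW : Cmod W <= 1 - s + 2 * s * d ^ 2 + 2 * K * s ^ 2 * q).
    { apply (ellipse_radius_le s K c d); auto; try lra. nra. }
    assert (Htz : Cmod (t * zeta) = t) by (rewrite Cmod_mult, Hzeta, Cmod_R, Rabs_pos_eq; lra).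
    specialize (Hp (t * zeta)%C ltac:(lra)). rewrite Htz in Hp.
    replace (nu * W * p (t * zeta))%C with (nu * W - nu * W * (1 - p (t * zeta)))%C by ring.
    set (v := (1 - p (t * zeta))%C) in *.
    unfold Cminus. rewrite re_plus, re_opp.
    assert (Hv : Re (nu * W * v) <= t * (1 - s + 2 * s * d ^ 2 + 2 * K * s ^ 2 * q)).
    { apply Rle_trans with (1 := Rle_abs _), Rle_trans with (1 := re_le_Cmod _).
      rewrite !Cmod_mult, Hnu, Rmult_1_l, Rmult_comm.
      apply Rmult_le_compat; auto using Cmod_ge_0. }
    assert (HR : Re (nu * W) = (1 - s) * c * x + (1 + s) * d * y).
    { unfold nu, W; simpl; ring. }
    rewrite HR.
    replace (2 * n + 1)%nat with (n + n + 1)%nat by lia. rewrite !pow_add.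
    simpl (t ^ 1). 
    match goal with |- ?L <= _ =>
      replace L with ((1 - s) * c * x + (1 + s) * d * y
        - t * (1 - s + 2 * s * d ^ 2 + 2 * K * s ^ 2 * q)) by (unfold s; ring) end.
    lra.
Qed.

(** * Extremal functions *)

(** h' = 1 - eps z is the rotation of 1 - z for which the bound
    |1 - h'| <= |z| is an equality everywhere. *)
Definition extremal_h (eps z : C) : C := (z - eps / 2 * z ^ 2)%C.

Definition extremal_g (lambda : C) (n : nat) (eps z : C) : C :=
  (lambda / (INR n + 1)%R * z ^ (n + 1) - lambda * eps / (INR n + 2)%R * z ^ (n + 2))%C.

Definition extremal_f (lambda : C) (n : nat) (eps z : C) : C :=
  (extremal_h eps z + Cconj (extremal_g lambda n eps z))%C.

Lemma extremal_h_derive (eps z : C) : has_Cderiv (extremal_h eps) z (1 - eps * z)%C.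
Proof.
apply has_Cderiv_ext with (fun w => w + (- (eps / 2)) * w ^ 2)%C.
- intro w; unfold extremal_h; ring.
- replace (1 - eps * z)%C with (1 + - (eps / 2) * INR 2 * z ^ 1)%C.
  + apply has_Cderiv_plus; [apply has_Cderiv_id|apply has_Cderiv_monomial].
  + simpl INR. replace (RtoC (1 + 1)) with (2 : C) by (f_equal; ring). simpl. field.
Qed.

Lemma extremal_h_derive2 (eps z : C) : has_Cderiv (C_derive (extremal_h eps)) z (- eps)%C.
Proof.
apply has_Cderiv_ext with (fun w => 1 + (- eps) * w ^ 1)%C.
- intro w. rewrite (has_Cderiv_unique _ _ _ (extremal_h_derive eps w)). simpl; ring.
- assert (H := has_Cderiv_plus _ _ z _ _ (has_Cderiv_const 1 z) (has_Cderiv_monomial (- eps) z 0)).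
  replace (0 + - eps * INR 1 * z ^ 0)%C with (- eps)%C in H by (simpl; ring).
  exact H.
Qed.

Lemma RtoC_pos_neq_0 (x : R) : 0 < x -> RtoC x <> 0%C.
Proof. intros Hx H; apply RtoC_inj in H; lra. Qed.

Lemma extremal_g_derive (lambda : C) (n : nat) (eps z : C) :
  has_Cderiv (extremal_g lambda n eps) z (lambda * z ^ n * (1 - eps * z))%C.
Proof.
assert (Hn := pos_INR n).
assert (H1 := RtoC_pos_neq_0 (INR n + 1) ltac:(lra)).
assert (H2 := RtoC_pos_neq_0 (INR n + 2) ltac:(lra)).
apply has_Cderiv_ext with (fun w => lambda / (INR n + 1)%R * w ^ S n
   + (- (lambda * eps / (INR n + 2)%R)) * w ^ S (S n))%C.
- intro w; unfold extremal_g.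
  replace (n + 1)%nat with (S n) by lia. replace (n + 2)%nat with (S (S n)) by lia. ring.
- replace (lambda * z ^ n * (1 - eps * z))%C with
   (lambda / (INR n + 1)%R * INR (S n) * z ^ n
    + - (lambda * eps / (INR n + 2)%R) * INR (S (S n)) * z ^ S n)%C.
  + apply has_Cderiv_plus; apply has_Cderiv_monomial.
  + rewrite !S_INR. replace (INR n + 1 + 1) with (INR n + 2) by ring.
    rewrite Cpow_S. field. split; assumption.
Qed.

(** v / (1 - v) maps the unit disk onto the half plane Re > - 1 / 2. *)
Lemma half_plane_condition (v : C) : Cmod v < 1 ->
  (1 - v)%C <> 0%C /\ Re (1 + - v / (1 - v))%C < 3 / 2.
Proof.
intro Hv.
assert (Hn : (1 - v)%C <> 0%C).
{ intro H. assert (v = 1%C) by (replace v with (1 - (1 - v))%C by ring; rewrite H; ring).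
  subst v. rewrite Cmod_1 in Hv; lra. }
split; [exact Hn|].
assert (Hv2 : Cmod v ^ 2 < 1) by (generalize (Cmod_ge_0 v); simpl; nra).
rewrite Cmod2_Re_Im in Hv2.
assert (HD : 0 < (1 - Re v) ^ 2 + Im v ^ 2).
{ assert (H := proj1 (Cmod_gt_0 _) Hn). apply (pow_lt _ 2) in H. rewrite Cmod2_alt in H.
  destruct v; simpl in *. lra. }
replace (Re (1 + - v / (1 - v))) with
  ((1 - 3 * Re v + 2 * (Re v * Re v + Im v * Im v)) / ((1 - Re v) ^ 2 + Im v ^ 2)).
- apply Rlt_div_l; [exact HD|]. nra.
- replace (1 + - v / (1 - v))%C with (1 + - (v / (1 - v)))%C by (field; exact Hn). 
  destruct v as [a c]; simpl in *. field. repeat split; simpl in *; lra.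
Qed.

Lemma extremal_class_F (lambda : C) (n : nat) (eps : C) :
  Cmod eps = 1 -> class_F (3 / 2) lambda n (extremal_f lambda n eps).
Proof.
intro Heps.
exists (extremal_h eps), (extremal_g lambda n eps); split.
- assert (Hn := pos_INR n).
  split; [|split; [|split; [|split; [|split]]]].
  + intros z _. exists (1 - eps * z)%C. apply is_derive_has_Cderiv, extremal_h_derive.
  + intros z _. exists (lambda * z ^ n * (1 - eps * z))%C. apply is_derive_has_Cderiv, extremal_g_derive.
  + reflexivity.
  + unfold extremal_f, extremal_h, extremal_g.
    rewrite !Cpow_add_r. simpl (0 ^ 2)%C. simpl (0 ^ 1)%C.
    apply injective_projections; simpl; ring.
  + rewrite (has_Cderiv_unique _ _ _ (extremal_h_derive eps 0)). ring.
  + exists (fun k => if Nat.eqb k 2 then (- (eps / 2))%C else 0%C),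
      (fun k => if Nat.eqb k (n + 1) then (lambda / (INR n + 1)%R)%C
         else if Nat.eqb k (n + 2) then (- (lambda * eps / (INR n + 2)%R))%C else 0%C).
    intros z Hz; split.
    * match goal with |- is_series ?a _ => set (u := a) end.
      replace (extremal_h eps z - z)%C with (u O) by (unfold u, extremal_h; simpl; ring).
      apply is_series_single. intros k Hk. unfold u.
      replace (Nat.eqb (k + 2) 2) with false by (symmetry; apply Nat.eqb_neq; lia). ring.
    * set (u := fun k : nat => if Nat.eqb k n then (lambda / (INR n + 1)%R * z ^ (n + 1))%C else 0%C).
      set (w := fun k : nat => if Nat.eqb k (S n) then (- (lambda * eps / (INR n + 2)%R) * z ^ (n + 2))%C else 0%C).
      apply (is_series_ext (fun k => plus (u k) (w k))).
      -- intro k. unfold u, w, plus; simpl.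
         destruct (Nat.eq_dec k n) as [->|H1].
         { rewrite !Nat.eqb_refl. replace (Nat.eqb n (S n)) with false by (symmetry; apply Nat.eqb_neq; lia). ring_in_C. }
         destruct (Nat.eq_dec k (S n)) as [->|H2].
         { replace (Nat.eqb (S n) n) with false by (symmetry; apply Nat.eqb_neq; lia).
           replace (Nat.eqb (S n + 1) (n + 1)) with false by (symmetry; apply Nat.eqb_neq; lia).
           replace (S n + 1)%nat with (n + 2)%nat by lia. rewrite !Nat.eqb_refl. ring_in_C. }
         replace (Nat.eqb k n) with false by (symmetry; apply Nat.eqb_neq; lia).
         replace (Nat.eqb k (S n)) with false by (symmetry; apply Nat.eqb_neq; lia).
         replace (Nat.eqb (k + 1) (n + 1)) with false by (symmetry; apply Nat.eqb_neq; lia).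
         replace (Nat.eqb (k + 1) (n + 2)) with false by (symmetry; apply Nat.eqb_neq; lia).
         ring_in_C.
      -- replace (extremal_g lambda n eps z) with (plus (u n) (w (S n))).
         ++ apply (is_series_plus (V := C_NormedModule)); apply is_series_single;
              intros k Hk; unfold u, w; rewrite (proj2 (Nat.eqb_neq _ _) Hk); reflexivity.
         ++ unfold u, w, extremal_g; rewrite !Nat.eqb_refl. unfold plus; simpl. ring_in_C.
- intros z Hz.
  rewrite (has_Cderiv_unique _ _ _ (extremal_h_derive eps z)),
    (has_Cderiv_unique _ _ _ (extremal_h_derive2 eps z)),
    (has_Cderiv_unique _ _ _ (extremal_g_derive lambda n eps z)).
  destruct (half_plane_condition (eps * z)%C) as [H1 H2].
  { rewrite Cmod_mult, Heps, Rmult_1_l. exact Hz. }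
  split; [exact H1|split; [|reflexivity]].
  replace (z * - eps)%C with (- (eps * z))%C by ring. exact H2.
Qed.

(** The free rotation eps aligns the two parts of f on a ray: s = -1 makes the
    co-analytic part oppose the analytic one, s = 1 makes it reinforce it. *)
Lemma extremal_rotation (lambda : C) (n : nat) (s : R) : Rabs s = 1 ->
  exists eps : C, Cmod eps = 1 /\ (Cconj lambda * eps ^ (n + 2))%C = RtoC (s * Cmod lambda).
Proof.
intro Hs. destruct (unit_polar lambda) as [u [Hu E]].
destruct (unit_root_exists (s * u) (S n)) as [eps [Heps Epow]].
{ rewrite Cmod_mult, Cmod_R, Hu, Hs; ring. }
exists eps; split; [exact Heps|].
replace (n + 2)%nat with (S (S n)) by lia. rewrite Epow, E at 1.
rewrite Cmult_conj. replace (Cconj (Cmod lambda)) with (RtoC (Cmod lambda))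
  by (apply injective_projections; simpl; ring).
replace (Cmod lambda * Cconj u * (s * u))%C with (s * Cmod lambda * (u * Cconj u))%C by ring.
rewrite Cmult_conj_unit by exact Hu. rewrite RtoC_mult; ring.
Qed.

(** On the diameter through conj(eps), h and conj(g) are real multiples of the
    same unit number.  The half k = 1 is the one where |h'| = 1 - r, the half
    k = -1 the one where |h'| = 1 + r. *)
Lemma extremal_value (lambda : C) (n : nat) (eps : C) (s k r : R) :
  Cmod eps = 1 -> (Cconj lambda * eps ^ (n + 2))%C = RtoC (s * Cmod lambda) ->
  extremal_f lambda n eps (k * r * Cconj eps)%C =
  (k * Cconj eps * RtoC (ray_poly n 1 (- k) (s * k ^ n * Cmod lambda) (- (s * k ^ n * Cmod lambda) * k) 0 r))%C.
Proof.
intros Heps Hrot. assert (Hn := pos_INR n).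
assert (H1 := RtoC_pos_neq_0 (INR n + 1) ltac:(lra)).
assert (H2 := RtoC_pos_neq_0 (INR n + 2) ltac:(lra)).
assert (Heps' := Cmult_conj_unit eps Heps).
assert (HR : forall x : R, Cconj x = RtoC x) by (intro; apply injective_projections; simpl; ring).
unfold extremal_f, extremal_h, extremal_g, ray_poly.
rewrite Cminus_conj, !Cmult_conj, !Cpow_conj, !Cdiv_conj, !Cmult_conj, !Cconj_conj, !HR by assumption.
rewrite Rmult_0_l, Rplus_0_r.
match goal with |- _ = (_ * RtoC ?X)%C => replace (RtoC X) with
  (r - k * r ^ 2 / 2 + RtoC (s * Cmod lambda) * k ^ n
     * (r ^ (n + 1) / (INR n + 1)%R - k * r ^ (n + 2) / (INR n + 2)%R))%C end.
- rewrite <- Hrot.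
  assert (He0 : eps <> 0%C) by (apply Cmod_gt_0; lra).
  replace (Cconj eps) with (/ eps)%C.
  + rewrite !Cpow_add_r, !Cpow_mult_l. simpl (_ ^ 1)%C. simpl (_ ^ 2)%C.
    field. repeat split; assumption.
  + rewrite <- (Cmult_1_l (Cconj eps)), <- (Cinv_l eps He0), <- Cmult_assoc, Heps'. ring.
- rewrite <- !RtoC_pow. unfold Cdiv. rewrite <- !RtoC_inv by lra.
  rewrite <- !RtoC_mult, <- !RtoC_minus, <- !RtoC_mult, <- !RtoC_plus.
  f_equal. field. lra.
Qed.

(** * The growth theorem *)

Theorem theorem5 :
  forall (n : nat) (lambda : C),
    (1 <= n)%nat -> Cmod lambda <= 1 / (INR n + 1) ->
    (forall (alpha : R) (f : C -> C),
        1 < alpha <= 3 / 2 -> class_F alpha lambda n f ->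
        forall (z : C) (r : R), Cmod z = r -> r < 1 ->
          growth_lower lambda n r <= Cmod (f z) <= growth_upper lambda n r) /\
    (exists f : C -> C, class_F (3 / 2) lambda n f /\
        forall r : R, 0 <= r < 1 ->
          exists z : C, Cmod z = r /\ Cmod (f z) = growth_lower lambda n r) /\
    (exists f : C -> C, class_F (3 / 2) lambda n f /\
        forall r : R, 0 <= r < 1 ->
          exists z : C, Cmod z = r /\ Cmod (f z) = growth_upper lambda n r).
Proof.
intros n lambda Hn Hlam.
assert (HN : 1 <= INR n) by (apply (le_INR 1), Hn).
assert (Hm := Cmod_ge_0 lambda).
split; [|split].
- intros alpha f [_ Halpha] HF z r <- Hr. split.
  + apply (class_F_lower alpha); auto.
  + apply (class_F_upper alpha); auto.
- destruct (extremal_rotation lambda n (-1)) as [eps [Heps Hrot]].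
  { rewrite Rabs_left; lra. }
  exists (extremal_f lambda n eps); split; [apply extremal_class_F, Heps|].
  intros r Hr. exists (1 * r * Cconj eps)%C; split.
  { rewrite !Cmod_mult, Cmod_conj, Heps, Cmod_1, Cmod_R, Rabs_pos_eq; lra. }
  rewrite (extremal_value lambda n eps (-1) 1 r Heps Hrot).
  match goal with |- Cmod (_ * RtoC ?X)%C = _ =>
    replace X with (growth_lower lambda n r)
      by (rewrite growth_lower_poly, pow1; f_equal; ring) end.
  rewrite !Cmod_mult, Cmod_conj, Heps, Cmod_1, Cmod_R, !Rmult_1_l.
  apply Rabs_pos_eq.
  unfold growth_lower.
  apply Rmult_le_pos; [lra|].
  assert (Hp : 0 <= r ^ n <= 1).
  { split; [apply pow_le; lra|]. rewrite <- (pow1 n); apply pow_incr; lra. }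
  set (q := 1 / (INR n + 1)) in *.
  assert (Hq : 0 <= q <= 1 / 2).
  { unfold q; split; [apply Rdiv_le_0_compat; lra|]. 
    unfold Rdiv; rewrite !Rmult_1_l; apply Rinv_le_contravar; lra. }
  assert (Hr2 : 0 <= r / (INR n + 2)) by (apply Rdiv_le_0_compat; lra).
  assert (0 <= Cmod lambda * r ^ n <= 1 / 2) by nra.
  assert (0 <= Cmod lambda * r ^ n * (r / (INR n + 2))) by (apply Rmult_le_pos; lra).
  assert (Cmod lambda * r ^ n * q <= 1 / 4) by nra.
  lra.
- destruct (extremal_rotation lambda n ((-1) ^ n)) as [eps [Heps Hrot]].
  { rewrite pow_1_abs. reflexivity. }
  exists (extremal_f lambda n eps); split; [apply extremal_class_F, Heps|].
  intros r Hr. exists ((-1)%R * r * Cconj eps)%C; split.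
  { rewrite !Cmod_mult, Cmod_conj, Heps, !Cmod_R, Rabs_left, Rabs_pos_eq; lra. }
  rewrite (extremal_value lambda n eps _ (-1) r Heps Hrot).
  assert (Hsign : (-1) ^ n * (-1) ^ n = 1).
  { rewrite <- Rpow_mult_distr. replace (-1 * -1) with 1 by ring. apply pow1. }
  match goal with |- Cmod (_ * RtoC ?X)%C = _ =>
    replace X with (growth_upper lambda n r)
      by (rewrite growth_upper_poly, Hsign; f_equal; ring) end.
  rewrite !Cmod_mult, Cmod_conj, Heps, !Cmod_R, (Rabs_left (-1)) by lra.
  rewrite Rabs_pos_eq; [ring|].
  rewrite growth_upper_poly. unfold ray_poly.
  assert (0 <= r ^ (n + 1) / (INR n + 1)) by (apply Rdiv_le_0_compat; [apply pow_le|]; lra).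
  assert (0 <= r ^ (n + 2) / (INR n + 2)) by (apply Rdiv_le_0_compat; [apply pow_le|]; lra).
  assert (0 <= r ^ 2) by apply pow2_ge_0.
  assert (0 <= Cmod lambda * (r ^ (n + 1) / (INR n + 1))) by (apply Rmult_le_pos; lra).
  assert (0 <= Cmod lambda * (r ^ (n + 2) / (INR n + 2))) by (apply Rmult_le_pos; lra).
  lra.
Qed.
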